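(* Let $n\ge1$, $N\ge n+1$ and let $\mathbf e=(e_1,\dots,e_n)$ be integers with $1\le e_1<\dots<e_n<N$. Let $r^1_{i,j}=N-e_j+e_i$ for $1\le i<j\le n$. Then for any orbit $\mathcal O\subset R_{\mathbf d}$ degenerating to $\mathcal O_{\mathbf r^1}$ there exists a point $M\in\mathcal O$ such that the PBW semi-standard Young tableaux (i.e. the corresponding PBW semi-standard monomials in Plücker coordinates) form a basis of the homogeneous coordinate ring of $\mathrm{Gr}_{\mathbf e}(M)$.
   Context: Everything is over $\mathbb C$. Let $V=\mathbb C^N$ with standard basis $v_1,\dots,v_N$, $\mathbf d=(N,\dots,N)$, and $R_{\mathbf d}=\mathrm{Hom}(V,V)^{n-1}$ the space of representations $M=(f_1,\dots,f_{n-1})$ of the equi-oriented quiver $1\to\dots\to n$, with $G_{\mathbf d}=GL(V)^n$ acting by base change. $\mathcal O_{\mathbf r}$ denotes the $G_{\mathbf d}$-orbit of those $(f_i)$ with $\mathrm{rank}(f_{j-1}\circ\dots\circ f_i)=r_{i,j}$ for all $i<j$. An orbit $\mathcal O$ degenerates to $\mathcal O'$ if $\mathcal O'\subset\overline{\mathcal O}$; here $\mathcal O_{\mathbf r}$ degenerates to $\mathcal O_{\mathbf r^1}$ iff $r_{i,j}\ge r^1_{i,j}$ for all $i<j$. $\mathrm{Gr}_{\mathbf e}(M)$ is the variety of tuples $(U_1,\dots,U_n)$ of subspaces of $V$ with $\dim U_i=e_i$, $f_i(U_i)\subset U_{i+1}$, embedded by Plücker in $\prod_{i=1}^n\mathbb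 P(\Lambda^{e_i}V)$. Its (multi-)homogeneous coordinate ring is the quotient of the polynomial ring in the Plücker coordinates $X_I$ ($I\subset\{1,\dots,N\}$, $\#I\in\{e_1,\dots,e_n\}$, taken with respect to $v_1,\dots,v_N$) by the ideal generated by all multi-homogeneous polynomials vanishing on $\mathrm{Gr}_{\mathbf e}(M)$. PBW semi-standard Young tableaux: for $\lambda=\sum_{i=1}^{N-1}m_i\omega_i$, $m_i\in\mathbb Z_{\ge0}$, consider the Young diagram with $m_i$ columns of length $i$, columns arranged with weakly decreasing lengths $l_1\ge l_2\ge\cdots$ from left to right. A PBW semi-standard tableau of shape $\lambda$ is a filling $T_{i,j}$ ($i$ the row, $j$ the column, $1\le i\le l_j$) with entries in $\{1,\dots,N\}$, distinct within each column, such that: (1) if $T_{i,j}\le l_j$ then $T_{i,j}=i$; (2) if $T_{i_1,j},T_{i_2,j}>l_j$, then $i_1<i_2$ implies $T_{i_1,j}>T_{i_2,j}$; (3) for any $j>1$ and $i\le l_j$ there exists $i_0$ with $i\le i_0\le l_{j-1}$ and $T_{i_0,j-1}\ge T_{i,j}$. Here only shapes with $m_i=0$ for $i\notin\{e_1,\dots,e_n\}$ are used. The monomial attached to a tableau $T$ is the product over its columns of the Plücker coordinates indexed by the entries of the column; such a monomial is called PBW semi-standard. *)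

(* Defs.v *)
From HB Require Import structures.
From mathcomp Require Import all_boot all_order all_algebra.
From mathcomp Require Import reals.
From mathcomp Require Import complex mpoly.
From mathcomp Require boolp.

Set Implicit Arguments.
Unset Strict Implicit.
Unset Printing Implicit Defensive.

Import GRing.Theory.
Local Open Scope ring_scope.
Local Open Scope quotient_scope.

(* Conventions.
   - Vertices 1, ..., n of the quiver are the elements of 'I_n, arrows are the
     elements of 'I_n.-1, the arrow k going from the vertex k to k+1 (0-based).
   - V is the space 'rV[K]_N of row vectors and a matrix acts on V by right
     multiplication, so the composite f_(j-1) o ... o f_i is the matrix product
     f_i * ... * f_(j-1), in this order.
   - The basis vectors v_1, ..., v_N are indexed from 0, by 'I_N. *)

Definition quiver_rep (K : fieldType) (n N : nat) := {ffun 'I_n.-1 -> 'M[K]_N}.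

Definition arrow_src (n : nat) (k : 'I_n.-1) : 'I_n := widen_ord (leq_pred n) k.

Lemma arrow_tgt_subproof (n : nat) (k : 'I_n.-1) : (k.+1 < n)%N.
Proof. by rewrite -ltn_predRL. Qed.

Definition arrow_tgt (n : nat) (k : 'I_n.-1) : 'I_n :=
  Ordinal (arrow_tgt_subproof k).

Section Representations.
Variables (K : fieldType) (n N : nat).
Implicit Types (f : quiver_rep K n N) (O : quiver_rep K n N -> Prop).

(* The composite f_(j-1) o ... o f_i. *)
Definition composite_map f (i j : 'I_n) : 'M[K]_N :=
  \prod_(k < n.-1 | (i <= k < j)%N) f k.

(* These ranks determine the isomorphism class of a representation, so the
   nonempty sets of this form are exactly the base change orbits. *)
Definition rank_orbit (r : 'I_n -> 'I_n -> nat) f : Prop :=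
  forall i j : 'I_n, (i < j)%N -> \rank (composite_map f i j) = r i j.

(* (g . f)_k = g_(k+1) o f_k o g_k^-1. *)
Definition base_change (g : 'I_n -> 'M[K]_N) f : quiver_rep K n N :=
  [ffun k => invmx (g (arrow_src k)) *m f k *m g (arrow_tgt k)].

Definition orbit_of f f' : Prop :=
  exists2 g : 'I_n -> 'M[K]_N,
    (forall i, g i \in unitmx) & f' = base_change g f.

Definition is_orbit O : Prop := exists f, forall f', O f' <-> orbit_of f f'.

Definition rep_coords f : 'I_#|{: 'I_n.-1 * 'I_N * 'I_N}| -> K :=
  fun t => let x := enum_val t in f x.1.1 x.1.2 x.2.

Definition zariski_closure O f' : Prop :=
  forall q : {mpoly K[#|{: 'I_n.-1 * 'I_N * 'I_N}|]},
    (forall f, O f -> q.@[rep_coords f] = 0) -> q.@[rep_coords f'] = 0.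

Definition degenerates_to O O' : Prop := forall f, O' f -> zariski_closure O f.

End Representations.

Section PluckerRing.
Variables (K : fieldType) (n N : nat) (e : 'I_n -> nat).

Definition plucker_index := {I : {set 'I_N} | #|I| \in codom e}.
HB.instance Definition _ := Finite.on plucker_index.
HB.instance Definition _ := SubType.on plucker_index.

(* The vertex i with #I = e i; it is unique when e is injective. *)
Definition plucker_level (I : plucker_index) : 'I_n := iinv (valP I).

Definition plucker_ring := {mpoly K[#|{: plucker_index}|]}.
HB.instance Definition _ := GRing.ComAlgebra.on plucker_ring.

Definition plucker_var (I : plucker_index) : plucker_ring := 'X_(enum_rank I).

Definition multidegree (m : 'X_{1..#|{: plucker_index}|}) (i : 'I_n) : nat :=
  (\sum_(I : plucker_index | plucker_level I == i) m (enum_rank I))%N.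

Definition multihomogeneous (p : plucker_ring) : Prop :=
  exists d : 'I_n -> nat,
    forall m, m \in msupp p -> forall i, multidegree m i = d i.

(* The minor, on the columns in I (in increasing order), of the matrix with
   rows b: the v_I-coordinate of b_1 /\ ... /\ b_#|I|. *)
Definition plucker_coord (b : seq 'rV[K]_N) (I : {set 'I_N}) : K :=
  \det (\matrix_(a < #|I|, c < #|I|) b`_a 0 (enum_val c)).

Definition plucker_point (b : forall i, (e i).-tuple 'rV[K]_N) :
    'I_#|{: plucker_index}| -> K :=
  fun t => let I := enum_val t in plucker_coord (b (plucker_level I)) (val I).

Definition quiver_grassmannian (M : quiver_rep K n N)
    (U : 'I_n -> {vspace 'rV[K]_N}) : Prop :=
  (forall i, \dim (U i) = e i) /\
  (forall k u, u \in U (arrow_src k) -> u *m M k \in U (arrow_tgt k)).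

(* Changing the bases b of the U_i runs over all the tuples of homogeneous
   coordinates of the point U, since every e i is positive. *)
Definition vanishes_on_grassmannian (M : quiver_rep K n N) (p : plucker_ring) :
    Prop :=
  forall U, quiver_grassmannian M U ->
  forall b : forall i, (e i).-tuple 'rV[K]_N,
    (forall i, basis_of (U i) (b i)) -> p.@[plucker_point b] = 0.

Definition ideal_generated (G : plucker_ring -> Prop) (p : plucker_ring) :
    Prop :=
  exists2 s : seq (plucker_ring * plucker_ring),
    (forall x, x \in s -> G x.2) & p = \sum_(x <- s) x.1 * x.2.

Definition vanishing_ideal (M : quiver_rep K n N) : {pred plucker_ring} :=
  fun p => boolp.asbool (ideal_generated
    (fun g => multihomogeneous g /\ vanishes_on_grassmannian M g) p).

End PluckerRing.

Section CoordinateRing.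
Variables (K : fieldType) (n N : nat) (e : 'I_n -> nat) (M : quiver_rep K n N).
Local Notation S := (plucker_ring K N e).
Local Notation I := (@vanishing_ideal K n N e M).

Lemma vanishing_idealMr (a : S) : {in I, forall p, a * p \in I}.
Proof.
move=> p /boolp.asboolP[s sG ->]; apply/boolp.asboolP.
exists [seq (a * x.1, x.2) | x <- s].
  by move=> _ /mapP[x xs ->]; exact: (sG x xs).
by rewrite big_map mulr_sumr; apply: eq_bigr => x _; rewrite mulrA.
Qed.

Lemma vanishing_ideal_zmod_closed : zmod_closed I.
Proof.
split=> [|p q /boolp.asboolP[s sG ->] Iq].
  by apply/boolp.asboolP; exists [::] => [x|]; rewrite ?in_nil ?big_nil.
have := vanishing_idealMr (-1) Iq; rewrite mulN1r => /boolp.asboolP[t tG ->].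
apply/boolp.asboolP; exists (s ++ t); last by rewrite big_cat.
by move=> x; rewrite mem_cat => /orP[/sG|/tG].
Qed.

HB.instance Definition _ := GRing.isZmodClosed.Build S I
  vanishing_ideal_zmod_closed.

(* {ideal_quot _} is restricted to proper ideals, while Gr_e(M) may be empty;
   hence the ring structure is put on the additive quotient here. *)
Definition coordinate_ring := Quotient.quot I.
HB.instance Definition _ := GRing.Zmodule.on coordinate_ring.

Definition coord_pi (p : S) : coordinate_ring := \pi_(Quotient.quot I) p.

Lemma coord_piP p q : (coord_pi p == coord_pi q) = (p - q \in I).
Proof. by rewrite Quotient.idealrBE. Qed.

Lemma coord_repr (x : coordinate_ring) : coord_pi (repr x) = x.
Proof. exact: reprK. Qed.

Lemma coord_piD : {morph coord_pi : p q / p + q}.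
Proof. by move=> p q; rewrite /coord_pi !piE. Qed.

Definition coord_one : coordinate_ring := coord_pi 1.
Definition coord_mul (x y : coordinate_ring) := coord_pi (repr x * repr y).
Definition coord_scale (a : K) (x : coordinate_ring) := coord_pi (a *: repr x).

Lemma coord_repr_pi p : repr (coord_pi p) - p \in I.
Proof. by rewrite -coord_piP coord_repr. Qed.

Lemma coord_piM : {morph coord_pi : p q / p * q >-> coord_mul p q}.
Proof.
move=> p q; apply/esym/eqP; rewrite coord_piP.
set p' := repr _; set q' := repr _.
have -> : p' * q' - p * q = q' * (p' - p) + p * (q' - q).
  by rewrite !mulrBr [q' * p']mulrC [q' * p]mulrC addrA subrK.
by apply: rpredD; apply: vanishing_idealMr; apply: coord_repr_pi.
Qed.

Lemma coord_piZ a : {morph coord_pi : p / a *: p >-> coord_scale a p}.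
Proof.
move=> p; apply/esym/eqP; rewrite coord_piP -scalerBr -mul_mpolyC.
exact/vanishing_idealMr/coord_repr_pi.
Qed.

Lemma coord_mulA : associative coord_mul.
Proof.
move=> x y z; rewrite -[x]coord_repr -[y]coord_repr -[z]coord_repr.
by rewrite -!coord_piM mulrA.
Qed.

Lemma coord_mulC : commutative coord_mul.
Proof. by move=> x y; rewrite /coord_mul mulrC. Qed.

Lemma coord_mul1 : left_id coord_one coord_mul.
Proof. by move=> x; rewrite -[x]coord_repr -coord_piM mul1r. Qed.

Lemma coord_mulDl : left_distributive coord_mul +%R.
Proof.
move=> x y z; rewrite -[x]coord_repr -[y]coord_repr -[z]coord_repr.
by rewrite -!(coord_piM, coord_piD) mulrDl.
Qed.

HB.instance Definition _ := GRing.Zmodule_isComPzRing.Build coordinate_ring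
  coord_mulA coord_mulC coord_mul1 coord_mulDl.

Lemma coord_scaleA a b x :
  coord_scale a (coord_scale b x) = coord_scale (a * b) x.
Proof. by rewrite -[x]coord_repr -!coord_piZ scalerA. Qed.

Lemma coord_scale1 : left_id 1 coord_scale.
Proof. by move=> x; rewrite -[x]coord_repr -coord_piZ scale1r. Qed.

Lemma coord_scaleDr : right_distributive coord_scale +%R.
Proof.
move=> a x y; rewrite -[x]coord_repr -[y]coord_repr.
by rewrite -!(coord_piZ, coord_piD) scalerDr.
Qed.

Lemma coord_scaleDl x : {morph coord_scale^~ x : a b / a + b}.
Proof.
move=> a b; rewrite -[x]coord_repr.
by rewrite -!(coord_piZ, coord_piD) scalerDl.
Qed.

HB.instance Definition _ := GRing.Zmodule_isLmodule.Build K coordinate_ring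
  coord_scaleA coord_scale1 coord_scaleDr coord_scaleDl.

End CoordinateRing.

(* Entries and row numbers are 0-based: the entry x stands for x + 1, and it is
   at most l exactly when (x < l)%N.  A tableau is the list of its columns, from
   left to right, a column being tagged by the vertex i such that it has length
   e i; the shape is thus read off the list. *)
Section Tableaux.
Variables (n N : nat) (e : 'I_n -> nat).

Definition pbw_column := {i : 'I_n & (e i).-tuple 'I_N}.
HB.instance Definition _ := Choice.on pbw_column.

Definition col_length (c : pbw_column) : nat := e (tag c).

Definition col_entry (c : pbw_column) (i : 'I_(col_length c)) : 'I_N :=
  tnth (tagged c) i.
Arguments col_entry : clear implicits.

Definition pbw_column_ok (c : pbw_column) : bool :=
  [&& uniq (tagged c),
      [forall i : 'I_(col_length c),
         (col_entry c i < col_length c)%N ==>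
         (col_entry c i == i :> nat)] &
      [forall i1 : 'I_(col_length c), forall i2 : 'I_(col_length c),
        [&& (col_length c <= col_entry c i1)%N,
            (col_length c <= col_entry c i2)%N & (i1 < i2)%N] ==>
        (col_entry c i2 < col_entry c i1)%N]].

(* The condition relating a column c to the column c' on its right. *)
Definition pbw_next (c c' : pbw_column) : bool :=
  (col_length c' <= col_length c)%N &&
  [forall i : 'I_(col_length c'), [exists i0 : 'I_(col_length c),
    (i <= i0)%N && (col_entry c' i <= col_entry c i0)%N]].

Definition pbw_semistandard (T : seq pbw_column) : bool :=
  all pbw_column_ok T && sorted pbw_next T.

Definition pbw_tableau := {T : seq pbw_column | pbw_semistandard T}.
HB.instance Definition _ := Choice.on pbw_tableau.
HB.instance Definition _ := SubType.on pbw_tableau.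

Definition col_set (c : pbw_column) : {set 'I_N} := [set x in tagged c].

(* The entries of a column with pbw_column_ok being distinct, their set has
   e (tag c) elements and the default value 1 is not reached. *)
Definition column_var (K : fieldType) (c : pbw_column) : plucker_ring K N e :=
  if insub (col_set c) is Some J then plucker_var K J else 1.

Definition pbw_monomial (K : fieldType) (T : pbw_tableau) :
    plucker_ring K N e :=
  \prod_(c <- val T) column_var K c.

End Tableaux.
Arguments col_entry {n N e} c i.

(* Every finite subfamily is free, and the family spans the space. *)
Definition is_basis (K : fieldType) (V : lmodType K) (J : eqType) (b : J -> V) :
    Prop :=
  (forall (s : seq J) (c : J -> K), uniq s ->
     \sum_(j <- s) c j *: b j = 0 -> forall j, j \in s -> c j = 0) /\
  (forall v, exists s c, v = \sum_(j <- s) c j *: b j).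

(* Main.v *)
Require Import Defs.
From HB Require Import structures.
From mathcomp Require Import all_boot all_order all_algebra all_fingroup.
From mathcomp Require Import reals.
From mathcomp Require Import complex mpoly.
From mathcomp Require Import zify ring.

(** The degeneration hypothesis only says that every arrow of a point of O has
    corank at most e_(k+1) - e_k ([degeneration_corank]).  This is enough to
    find in O a representation M that has a subrepresentation U of dimension e
    on which all arrows are injective and modulo which they are surjective.  In
    bases adapted to U each arrow M_k is the coordinate projection killing the
    v_b with e_k < b <= e_(k+1), plus a block R_k from a complement of U to U
    ([normal_arrow], [normal_rep_exists]).  The representation M0 with R = 0
    lies in the most degenerate orbit, and the diagonal one-parameter group
    acting with weight 1 on U and 0 on the complement contracts M to M0.  Since
    it is diagonal it only rescales the Plücker coordinates, so both halves of
    the theorem can be read off from leading terms at M0.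

    Spanning.  Let c and c' be neighbouring columns, c' to the right of c,
    violating condition (3) at row i of c'.  Antisymmetrize over the entries of
    c in rows >= i and those of c' in rows <= i, which are one more than the
    dimension of the subspace attached to c, where all these functionals live
    once those of c' are pulled back along the composite arrow: the sum is
    zero ([plucker_relation]).
    The terms that are not the original one have smaller weight when R is used,
    and otherwise the staircase of maxima of the right-hand column has decreased
    ([exchange_weight], [stair_code_exchange]).  Hence the rewriting stops, at
    semi-standard tableaux ([col_mon_spanned], [pbw_monomials_span]).

    Independence.  The quiver Grassmannian contains the points
    U_(k+1) = M_k(U_k) + (new vectors v_a + sum_(b > e_(k+1)) x_ab v_b, for
    e_k < a <= e_(k+1)).  To lowest order in x the space U_k is the row space
    of (1 | x), as for M0, and X_I becomes, up to sign, a minor of the generic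
    matrix x ([minor_chart_lead]).  For a suitable weight on the x_ab the
    initial monomial of the minor attached to a column is the product of the
    x_(i, T_i) over its entries T_i exceeding the length ([minor_initial]).  The
    shape and the product of these monomials over the columns determine the
    tableau, because the pairs (i, T_i) coming from the first column are exactly
    the maximal ones among those whose entry exceeds the length of that column
    ([tableau_from_exponents]).  Distinct monomials are
    independent functions, and independence lifts from initial terms
    ([lin_indep_of_lead]). *)

Set Implicit Arguments.
Unset Strict Implicit.
Unset Printing Implicit Defensive.
Import Order.TTheory GRing.Theory Num.Theory.
Local Open Scope ring_scope.

(** * Normal form of a representation *)

Section NormalForm.
Variables (K : fieldType) (N : nat).
Local Notation pid r := (pid_mx r : 'M[K]_N).
Implicit Types (A B C F X Y : 'M[K]_N) (p q r : nat).

(** An arrow in bases adapted to a subrepresentation that it embeds (the first p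
    basis vectors) and modulo which it is surjective: only the block with source
    rows >= p and target columns < q is free. *)
Definition normal_arrow p q F : Prop :=
  forall a b : 'I_N, (a < p)%N || (q <= b)%N -> F a b = (a == b)%:R.

Lemma normal_arrow_comp p q r F F' : (p <= q)%N -> (q <= r)%N ->
  normal_arrow p q F -> normal_arrow q r F' -> normal_arrow p r (F *m F').
Proof.
move=> pq qr nF nF' a b /orP[ap|rb]; rewrite mxE.
  rewrite (bigD1 a) //= nF ?ap // eqxx mul1r nF' ?(leq_trans ap pq) //.
  by rewrite big1 ?addr0 // => j ja; rewrite nF ?ap // eq_sym (negPf ja) mul0r.
rewrite (bigD1 b) //= nF' ?rb ?orbT // eqxx mulr1 nF ?(leq_trans qr rb) ?orbT //.
by rewrite big1 ?addr0 // => j jb; rewrite nF' ?rb ?orbT // (negPf jb) mulr0.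
Qed.

Lemma normal_arrow1 p : normal_arrow p p 1%:M.
Proof. by move=> a b _; rewrite mxE. Qed.

Lemma pid_mul r A i j :
  (pid r *m A) i j = if (i < r)%N then A i j else 0.
Proof.
rewrite mxE (bigD1 i) //= big1 ?addr0 => [|k ki]; last first.
  by rewrite mxE eq_sym (inj_eq val_inj) (negPf ki) mul0r.
by rewrite mxE eqxx; case: ifP; rewrite ?mul1r ?mul0r.
Qed.

Lemma pid_pid r s : (r <= s)%N -> pid r *m pid s = pid r.
Proof.
move=> rs; apply/matrixP => i j; rewrite pid_mul !mxE.
by case: ltnP => ir; rewrite ?(leq_trans ir rs) // andbF.
Qed.

Lemma mul_pid r A i j :
  (A *m pid r) i j = if (j < r)%N then A i j else 0.
Proof.
rewrite mxE (bigD1 j) //= big1 ?addr0 => [|k ki]; last first.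
  by rewrite mxE (inj_eq val_inj) (negPf ki) mulr0.
by rewrite mxE eqxx; case: ifP; rewrite ?mulr1 ?mulr0.
Qed.

Lemma mul_copid r A i j :
  (A *m copid_mx r) i j = if (j < r)%N then 0 else A i j.
Proof.
rewrite /copid_mx mulmxBr mulmx1 mxE [X in _ + X]mxE mul_pid.
by case: ifP; rewrite ?subrr ?subr0.
Qed.

Lemma copid_mul r A i j :
  (copid_mx r *m A) i j = if (i < r)%N then 0 else A i j.
Proof.
rewrite /copid_mx mulmxBl mul1mx mxE [X in _ + X]mxE pid_mul.
by case: ifP; rewrite ?subrr ?subr0.
Qed.

Lemma tr_copid_mx r : (copid_mx r)^T = copid_mx r :> 'M[K]_N.
Proof. by rewrite /copid_mx linearB /= tr_pid_mx trmx1. Qed.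

(** A vector space is not the union of two proper subspaces, here the preimage
    of A under C and X, unless X is everything. *)
Lemma avoid_two A C X : (\rank A < \rank C)%N ->
  exists v : 'rV[K]_N, ~~ (v *m C <= A)%MS /\ (row_full X \/ ~~ (v <= X)%MS).
Proof.
move=> AC.
have /row_subPn[i Ai] : ~~ (C <= A)%MS.
  by apply/negP => /mxrankS; rewrite leqNgt AC.
have {}Ai : ~~ ((delta_mx 0 i : 'rV_N) *m C <= A)%MS by rewrite -rowE.
set v := delta_mx 0 i in Ai.
have [Xf|] := boolP (row_full X); first by exists v; split; [|left].
rewrite -sub1mx => /row_subPn[j Xj]; set w := row j _ in Xj.
have [Xv|Xv] := boolP (v <= X)%MS; last by exists v; split; [|right].
have [Aw|Aw] := boolP (w *m C <= A)%MS; last by exists w; split; [|right].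
exists (v + w); split; last right; apply/negP.
  rewrite mulmxDl => h; case/negP: Ai.
  by rewrite -[_ *m C](addrK (w *m C)) addmx_sub // eqmx_opp.
move=> h; case/negP: Xj.
by rewrite -[w](addrK v) addrC addmx_sub ?eqmx_opp // addrC.
Qed.

Lemma rank_add_row p (A : 'M[K]_(p, N)) (v : 'rV_N) :
  ~~ (v <= A)%MS -> \rank (A + v)%MS = (\rank A).+1.
Proof.
move=> vA; have v0 : v != 0 by apply: contraNneq vA => ->; rewrite sub0mx.
rewrite mxrank_disjoint_sum ?rank_rV ?v0 ?addn1 //.
apply/eqP; apply: contraNT vA => Av0; rewrite (submx_trans _ (capmxSl A v)) //.
rewrite -(mxrank_leqif_sup (capmxSr A v)) eqn_leq mxrankS ?capmxSr //=.
by rewrite rank_rV v0 lt0n mxrank_eq0.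
Qed.

Lemma rank_pid_le r A C : (\rank (pid r *m A *m C) <= r)%N.
Proof.
rewrite -mulmxA (leq_trans (mxrankM_maxl (pid r : 'M_N) (A *m C))) //.
have [rN|Nr] := leqP r N; first by rewrite rank_pid_mx.
by rewrite (leq_trans (rank_leq_row _)) // ltnW.
Qed.

(** The rows p, ..., q - 1 are added one at a time, each chosen off the two
    subspaces that would spoil the two conclusions. *)
Lemma extend_rows p q A C F : (p <= q)%N -> (q <= N)%N ->
    \rank (pid p *m A *m C) = p -> (N <= \rank F + (q - p))%N ->
    (q <= \rank C)%N ->
  exists B, [/\ pid p *m B = pid p *m A,
    \rank (pid q *m B *m C) = q & row_full (pid q *m B + F)%MS].
Proof.
move=> pq qN rA rF rC.
have main d : (p + d <= q)%N -> exists B, [/\ pid p *m B = pid p *m A,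
    \rank (pid (p + d) *m B *m C) = (p + d)%N &
    (N <= \rank (pid (p + d) *m B + F)%MS + (q - (p + d)))%N].
  elim: d => [_|d IH dq].
    exists A; rewrite addn0; split=> //.
    by rewrite (leq_trans rF) // leq_add2r mxrankS // addsmxSr.
  rewrite addnS in dq *; have [|B [B1 B2 B3]] := IH; first by rewrite ltnW.
  set r := (p + d)%N in dq B2 B3 *.
  have rN : (r < N)%N by rewrite (leq_trans dq).
  have [|v [vA vX]] := @avoid_two (pid r *m B *m C) C
    (pid r *m B + F)%MS; first by rewrite B2 (leq_trans dq).
  pose B' : 'M[K]_N := \matrix_(i, j) if i == r :> nat then v 0 j else B i j.
  have pB' s : (s <= r)%N -> pid s *m B' = pid s *m B.
    move=> sr; apply/matrixP => i j; rewrite !pid_mul mxE.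
    by case: ifP => // i_s; rewrite ltn_eqF // (leq_trans i_s sr).
  have vB' : v = delta_mx 0 (Ordinal rN) *m (pid r.+1 *m B').
    by apply/rowP => j; rewrite -rowE mxE pid_mul ltnSn mxE /= eqxx.
  have AB' : pid r *m B = pid r *m (pid r.+1 *m B').
    by rewrite mulmxA pid_pid ?pB'.
  exists B'; split; first by rewrite pB' // leq_addr.
  - apply/eqP; rewrite eqn_leq rank_pid_le -[X in (X < _)%N]B2.
    rewrite -(rank_add_row vA) mxrankS // addsmx_sub.
    by rewrite AB' vB' -!(mulmxA _ _ C) !submxMl.
  - have S : (pid r *m B + F <= pid r.+1 *m B' + F)%MS.
      by rewrite addsmxS // AB' submxMl.
    case: vX => [|vX].
      rewrite -col_leq_rank => Xf.
      by rewrite (leq_trans Xf) // (leq_trans (mxrankS S)) ?leq_addr.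
    rewrite (leq_trans B3) // -(subnSK dq) addnS -addSn leq_add2r.
    rewrite -(rank_add_row vX) mxrankS // addsmx_sub S /=.
    by rewrite (submx_trans _ (addsmxSl _ _)) // vB' submxMl.
have [|B [B1 B2 B3]] := main (q - p)%N; first by rewrite subnKC.
rewrite subnKC // in B2 B3.
exists B; split=> //; rewrite -col_leq_rank.
by rewrite subnn addn0 in B3.
Qed.

Lemma extend_basis p q A C F : (p <= q)%N -> (q <= N)%N ->
    \rank (pid p *m A *m C) = p -> (N <= \rank F + (q - p))%N ->
    (q <= \rank C)%N ->
  exists2 h : 'M[K]_N, h \in unitmx & [/\ pid p *m h = pid p *m A,
    \rank (pid q *m h *m C) = q & row_full (pid q *m h + F)%MS].
Proof.
move=> pq qN rA rF rC; have [B [B1 B2 B3]] := extend_rows pq qN rA rF rC.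
have [|h hu hB] := @complete_unitmx _ _ _ (pid q : 'M_N) B.
  apply/eqP; rewrite eqn_leq mxrankM_maxl rank_pid_mx // -{1}B2.
  exact: mxrankM_maxl.
exists h => //; rewrite -hB; split=> //.
by rewrite -B1 -(pid_pid pq) -!mulmxA hB.
Qed.

Lemma copid_mul_pid p q : (p <= q)%N -> copid_mx q *m pid p = 0.
Proof.
move=> pq; apply/matrixP => i j; rewrite copid_mul !mxE.
by case: ltnP => // qi; rewrite andbC ltnNge (leq_trans pq qi).
Qed.

Lemma pid_mul_copid p q : (p <= q)%N -> pid p *m copid_mx q = 0.
Proof.
by move=> pq; apply: trmx_inj; rewrite trmx_mul tr_copid_mx tr_pid_mx
   copid_mul_pid ?trmx0.
Qed.

Lemma rank_pid_copid p q Y : (p <= q)%N -> (q <= N)%N ->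
    \rank (Y *m copid_mx q) = (N - q)%N -> pid p *m Y *m copid_mx q = 0 ->
  \rank (copid_mx q *m Y^T + pid p)%R = (N - q + p)%N.
Proof.
move=> pq qN rY Y0; have pN := leq_trans pq qN.
set f : 'M[K]_N := copid_mx q *m Y^T + pid p.
have cpq := copid_mul_pid pq; have pcq := pid_mul_copid pq.
have cqq : copid_mx q *m copid_mx q = copid_mx q :> 'M[K]_N.
  exact: copid_mx_id.
have ppp : pid p *m pid p = pid p by exact: pid_pid.
apply/eqP; rewrite eqn_leq; apply/andP; split.
  rewrite (leq_trans (mxrank_add _ _)) // rank_pid_mx // leq_add2r.
  by rewrite (leq_trans (mxrankM_maxl _ _)) // rank_copid_mx.
have Sc : (copid_mx q *m Y^T <= f)%MS.
  apply/submxP; exists (copid_mx q).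
  by rewrite mulmxDr mulmxA cqq cpq addr0.
have Sp : (pid p <= f)%MS.
  apply/submxP; exists (pid p).
  by rewrite mulmxDr mulmxA pcq ppp mul0mx add0r.
have -> : (N - q + p)%N = \rank (copid_mx q *m Y^T + pid p)%MS.
  rewrite mxrank_disjoint_sum; last first.
    apply/eqP; rewrite -submx0; apply/rV_subP => v; rewrite sub_capmx.
    case/andP => /submxP[x ->] /submxP[y xy].
    rewrite xy -ppp mulmxA -xy -!mulmxA.
    have -> : copid_mx q *m (Y^T *m pid p) = 0.
      apply: trmx_inj; rewrite !trmx_mul trmxK tr_pid_mx tr_copid_mx.
      by rewrite trmx0.
    by rewrite mulmx0 sub0mx.
  rewrite rank_pid_mx // -mxrank_tr trmx_mul trmxK.
  by rewrite tr_copid_mx rY.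
by rewrite mxrankS // addsmx_sub Sc.
Qed.

(** First complete the prescribed last columns and the first p unit columns to
    an invertible matrix, which may leave a nonzero block in the first p rows;
    this block is removed by the shear 1 - Z, where Z squares to zero. *)
Lemma complete_corner p q Y : (p <= q)%N -> (q <= N)%N ->
    \rank (Y *m copid_mx q) = (N - q)%N -> pid p *m Y *m copid_mx q = 0 ->
  exists2 X, X \in unitmx &
    pid p *m X = pid p /\ X *m copid_mx q = Y *m copid_mx q.
Proof.
move=> pq qN rY Y0.
have pN := leq_trans pq qN.
pose U : 'M[K]_N := copid_mx q + pid p.
pose f : 'M[K]_N := copid_mx q *m Y^T + pid p.
have cpq := copid_mul_pid pq; have pcq := pid_mul_copid pq.
have cqq : copid_mx q *m copid_mx q = copid_mx q :> 'M[K]_N.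
  exact: copid_mx_id.
have ppp : pid p *m pid p = pid p by exact: pid_pid.
have Uf : U *m f = f.
  by rewrite mulmxDl !mulmxDr !mulmxA cqq cpq pcq ppp mul0mx !addr0 add0r.
have rf : \rank f = (N - q + p)%N by exact: rank_pid_copid.
have rU : \rank U = (N - q + p)%N.
  have <- : copid_mx q *m 1%:M^T + pid p = U by rewrite trmx1 mulmx1.
  apply: rank_pid_copid => //; first by rewrite mul1mx rank_copid_mx.
  by rewrite mulmx1.
have [|g gu] := @complete_unitmx _ _ _ U f.
  by rewrite Uf rf.
rewrite Uf => fg.
have gp : pid p *m g = pid p.
  have <- : pid p *m U = pid p by rewrite mulmxDr pcq ppp add0r.
  rewrite -mulmxA -fg mulmxDr mulmxA pcq ppp mul0mx add0r.
  by rewrite mulmxDr pcq ppp add0r.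
have gq : copid_mx q *m g = copid_mx q *m Y^T.
  have -> : copid_mx q *m g = copid_mx q *m (U *m g).
    by rewrite mulmxA mulmxDr cpq cqq addr0.
  by rewrite -fg mulmxDr mulmxA cqq cpq addr0.
pose X := g^T.
have Xp : X *m pid p = pid p by rewrite -[LHS]trmxK trmx_mul trmxK tr_pid_mx gp tr_pid_mx.
have Xq : X *m copid_mx q = Y *m copid_mx q.
  by rewrite -[LHS]trmxK trmx_mul trmxK tr_copid_mx gq trmx_mul trmxK tr_copid_mx.
(* The block of X that has to be removed. *)
pose Z := pid p *m X *m copid_mx p.
have cp0 : copid_mx p *m pid p = 0 :> 'M[K]_N by rewrite mul_copid_mx_pid.
have ZZ : Z *m Z = 0.
  by rewrite /Z -!mulmxA [copid_mx p *m (pid p *m _)]mulmxA cp0 mul0mx !mulmx0.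
have XZ : X *m Z = Z by rewrite /Z !mulmxA Xp.
exists (X *m (1%:M - Z)).
  rewrite unitmx_mul unitmx_tr gu /=.
  suff /mulmx1_unit[] : (1%:M - Z) *m (1%:M + Z) = 1%:M by [].
  by rewrite mulmxBl mul1mx mulmxDr mulmx1 ZZ addr0 addrK.
split.
  rewrite mulmxA mulmxBr mulmx1 /Z !mulmxA -(mulmxA _ X (pid p)) Xp ppp.
  by rewrite /copid_mx mulmxBr mulmx1 -(mulmxA _ X) Xp ppp opprB addrC subrK.
rewrite (mulmxBr X) mulmx1 XZ mulmxBl Xq /Z -(mulmxA _ _ (copid_mx q)).
have -> : copid_mx p *m copid_mx q = copid_mx q :> 'M[K]_N.
  by rewrite {1}/copid_mx mulmxBl mul1mx pcq subr0.
by rewrite -mulmxA Xq mulmxA Y0 subr0.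
Qed.

(** The rows of h_k with index < E k span the subspaces U_k of a
    subrepresentation, and each arrow maps the chosen basis of U_k into that of
    U_(k+1).  The matrix C k stands for the composite of all the arrows from k
    on; keeping U_k off its kernel is what allows the construction to go on. *)
Lemma upward_chain (E : nat -> nat) (F C : nat -> 'M[K]_N) :
    (forall k, (E k <= E k.+1)%N) -> (forall k, (E k <= N)%N) ->
    (forall k, (N <= \rank (F k) + (E k.+1 - E k))%N) ->
    (forall k, C k = F k *m C k.+1) -> (forall k, (E k <= \rank (C k))%N) ->
  exists h : nat -> 'M[K]_N, forall k, [/\ h k \in unitmx,
    pid (E k) *m h k *m F k = pid (E k) *m h k.+1 &
    row_full (pid (E k.+1) *m h k.+1 + F k)%MS].
Proof.
move=> Ei EN rF CF rC.
pose P k h := h \in unitmx /\ \rank (pid (E k) *m h *m C k) = E k.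
pose S k (h h' : 'M[K]_N) := [/\ P k.+1 h',
  pid (E k) *m h *m F k = pid (E k) *m h' &
  row_full (pid (E k.+1) *m h' + F k)%MS].
(* The first subspace is an extension of the zero space; no arrow enters the
   first vertex, so the identity is used as incoming arrow. *)
have [h0 Ph0] : exists h, P 0%N h.
  have [||h hu [_ h2 _]] := @extend_basis 0 (E 0%N) 0 (C 0%N) 1%:M
    (leq0n _) (EN 0%N) _ _ (rC 0%N).
  - by rewrite mulmx0 mul0mx mxrank0.
  - by rewrite mxrank1 leq_addr.
  by exists h.
have step (kh : nat * 'M[K]_N) : exists h', P kh.1 kh.2 -> S kh.1 kh.2 h'.
  case: kh => k h /=; have [[hu hC]|nP] := boolp.pselect (P k h); last first.
    by exists 0.
  have [|h' hu' [h1 h2 h3]] :=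
    @extend_basis (E k) (E k.+1) (h *m F k) (C k.+1) (F k) (Ei k) (EN k.+1)
      _ (rF k) (rC k.+1).
    by rewrite mulmxA -mulmxA -CF.
  by exists h' => _; split; rewrite // -mulmxA h1.
have [f fP] := boolp.choice step.
pose h := fix h k := if k is k'.+1 then f (k', h k') else h0.
have Ph k : P k (h k) by elim: k => // k IH; case: (fP (k, h k) IH).
by exists h => k; have [_ ? ?] := fP (k, h k) (Ph k); case: (Ph k).
Qed.

(** Dually, linear forms vanishing on U_(k+1) are pulled back to forms vanishing
    on U_k, and stay independent because the arrow is surjective modulo U_(k+1).
    Hence the construction goes from the last vertex to the first one. *)
Lemma downward_chain m (E : nat -> nat) (F h : nat -> 'M[K]_N) :
    (forall k, (E k <= E k.+1)%N) -> (forall k, (E k <= N)%N) ->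
    (forall k, [/\ h k \in unitmx,
      pid (E k) *m h k *m F k = pid (E k) *m h k.+1 &
      row_full (pid (E k.+1) *m h k.+1 + F k)%MS]) ->
  exists g : nat -> 'M[K]_N,
    (forall k, (k <= m)%N -> g k \in unitmx /\
       pid (E k) *m h k *m g k = pid (E k)) /\
    (forall k, (k < m)%N ->
       F k *m g k.+1 *m copid_mx (E k.+1) = g k *m copid_mx (E k.+1)).
Proof.
move=> Ei EN hP.
suff main d : (d <= m)%N -> exists g : nat -> 'M[K]_N,
    (forall k, (m - d <= k <= m)%N -> g k \in unitmx /\
       pid (E k) *m h k *m g k = pid (E k)) /\
    (forall k, (m - d <= k < m)%N ->
       F k *m g k.+1 *m copid_mx (E k.+1) = g k *m copid_mx (E k.+1)).
  have [g [g1 g2]] := main m (leqnn m).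
  by rewrite subnn in g1 g2; exists g; split=> k km; [apply: g1|apply: g2].
elim: d => [_|d IH dm].
  exists (fun k => invmx (h k)); rewrite subn0; split=> k.
    by rewrite -eqn_leq => /eqP <-; have [hu _ _] := hP m;
       rewrite unitmx_inv hu mulmxK.
  by move=> /andP[mk km]; lia.
have [g [g1 g2]] := IH (ltnW dm); pose k := (m - d.+1)%N.
have kS : (m - d)%N = k.+1 by rewrite /k; lia.
have [gu gh] : g k.+1 \in unitmx /\ pid (E k.+1) *m h k.+1 *m g k.+1 = pid (E k.+1).
  by apply: g1; rewrite kS leqnn /=; rewrite /k; lia.
have [hu hF hfull] := hP k; have [hu' _ _] := hP k.+1.
set p := E k in hF *; set q := E k.+1 in gh hfull *.
have pq : (p <= q)%N by exact: Ei.
have qN : (q <= N)%N by exact: EN.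
have [||X Xu [X1 X2]] := @complete_corner p q (h k *m F k *m g k.+1) pq qN.
- set c := copid_mx q; apply/eqP; rewrite eqn_leq.
  rewrite (leq_trans (mxrankM_maxr _ _)) ?rank_copid_mx //=.
  rewrite -!mulmxA (eqmxMfull _ (_ : row_full (h k))) ?row_full_unit //.
  move: hfull; rewrite -sub1mx => /sub_addsmxP[[B B'] /= BB].
  have -> : (N - q)%N = \rank (g k.+1 *m c).
    by rewrite (eqmxMfull _ (_ : row_full (g k.+1))) ?row_full_unit ?rank_copid_mx.
  have gcE : g k.+1 *m c = B' *m (F k *m (g k.+1 *m c)).
    rewrite -[LHS]mul1mx BB mulmxDl -(pid_pid (leqnn q)) -!mulmxA.
    rewrite [pid q *m (h _ *m _)]mulmxA [pid q *m h _ *m (_ *m _)]mulmxA gh.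
    by rewrite mul_pid_mx_copid // !mulmx0 add0r.
  by rewrite {1}gcE mxrankM_maxr.
- rewrite !mulmxA hF -(pid_pid pq) -2!(mulmxA (pid p)) gh -mulmxA.
  by rewrite mul_pid_mx_copid // mulmx0.
exists (fun j => if j == k then invmx (h k) *m X else g j); split=> j jk.
  case: eqP => [->|/eqP jk0].
    by rewrite unitmx_mul unitmx_inv hu Xu mulmxA mulmxK.
  by apply: g1; lia.
have -> : (j.+1 == k) = false by lia.
case: eqP => [->|/eqP jk0]; last by apply: g2; lia.
by rewrite -(mulmxA _ X) X2 !mulmxA mulVmx // mul1mx.
Qed.

Lemma normal_form m (E : nat -> nat) (F C : nat -> 'M[K]_N) :
    (forall k, (E k <= E k.+1)%N) -> (forall k, (E k <= N)%N) ->
    (forall k, (N <= \rank (F k) + (E k.+1 - E k))%N) ->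
    (forall k, C k = F k *m C k.+1) -> (forall k, (E k <= \rank (C k))%N) ->
  exists2 g : nat -> 'M[K]_N, forall k, (k <= m)%N -> g k \in unitmx &
    forall k, (k < m)%N ->
      normal_arrow (E k) (E k.+1) (invmx (g k) *m F k *m g k.+1).
Proof.
move=> Ei EN rF CF rC; have [h hP] := upward_chain Ei EN rF CF rC.
have [g [gu gF]] := downward_chain m Ei EN hP.
exists g => [k km|k km]; first by case: (gu k km).
have [gku hg] := gu k (ltnW km); have [gku' hg'] := gu _ km.
have [_ hF _] := hP k.
set M := invmx (g k) *m F k *m g k.+1 => a b /orP[ap|qb].
  have /matrixP/(_ a b) : pid (E k) *m M = pid (E k).
    rewrite -{1}hg /M !mulmxA mulmxK // hF -(pid_pid (Ei k)).
    by rewrite -2!(mulmxA (pid (E k))) hg'.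
  by rewrite pid_mul ap => ->; rewrite mxE ap andbT.
have /matrixP/(_ a b) : M *m copid_mx (E k.+1) = copid_mx (E k.+1).
  by rewrite /M -!mulmxA [F k *m _]mulmxA gF // mulKmx.
by rewrite mul_copid ltnNge qb /= => ->; rewrite /copid_mx !mxE (inj_eq val_inj);
  case: eqP => [->|_] /=;
  rewrite ?ltnNge ?qb subr0.
Qed.

End NormalForm.

(** * Consequences of the degeneration hypothesis *)

Section Degeneration.
Variables (K : fieldType) (n N : nat) (e : 'I_n -> nat).
Hypothesis (e_le : forall i, (e i <= N)%N)
  (e_mono : forall i j : 'I_n, (i <= j)%N -> (e i <= e j)%N).

Definition coord_proj (S : pred nat) : 'M[K]_N :=
  \matrix_(a, b) ((a == b) && ~~ S a)%:R.

Lemma coord_projM S T :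
  coord_proj S *m coord_proj T = coord_proj [pred a | S a || T a].
Proof.
apply/matrixP => a b; rewrite !mxE (bigD1 a) //= big1 ?addr0 => [|c ca].
  by rewrite !mxE eqxx /= -natrM mulnb negb_or; congr (nat_of_bool _)%:R;
     case: (a == b); case: (S a); case: (T a).
by rewrite mxE eq_sym (negPf ca) mul0r.
Qed.

Lemma eq_coord_proj S T : S =1 T -> coord_proj S = coord_proj T.
Proof. by move=> ST; apply/matrixP => a b; rewrite !mxE ST. Qed.

Lemma coord_proj_interval p q : (p <= q)%N ->
  coord_proj (fun a => p <= a < q)%N = copid_mx q + pid_mx p.
Proof.
move=> pq; apply/matrixP => a b; rewrite /copid_mx !mxE (inj_eq val_inj).
case: eqP => [->|] /=; last by rewrite subr0 addr0.
by case: (ltnP b p) => [bp|pb]; case: (ltnP b q) => [bq|qb] /=;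
  rewrite ?subrr ?add0r ?subr0 ?addr0 //; lia.
Qed.

Lemma rank_coord_proj p q : (p <= q)%N -> (q <= N)%N ->
  \rank (coord_proj (fun a => p <= a < q)%N) = (N - q + p)%N.
Proof.
move=> pq qN; rewrite coord_proj_interval // -[copid_mx q]mulmx1 -trmx1.
apply: rank_pid_copid => //; first by rewrite mul1mx rank_copid_mx.
by rewrite mulmx1 pid_mul_copid.
Qed.

(** The standard point of the most degenerate orbit. *)
Definition pbw_rep : quiver_rep K n N :=
  [ffun k => coord_proj (fun a => e (arrow_src k) <= a < e (arrow_tgt k))%N].

Lemma pbw_rep_orbit : rank_orbit (fun i j => N - e j + e i)%N pbw_rep.
Proof.
move=> i j ij; rewrite /composite_map.
have -> : \prod_(k < n.-1 | (i <= k < j)%N) pbw_rep k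
        = coord_proj [pred a | has (fun k : 'I_n.-1 => (i <= k < j)%N &&
            (e (arrow_src k) <= a < e (arrow_tgt k))%N) (index_enum 'I_n.-1)].
  elim: (index_enum _) => [|k r IH].
    by rewrite big_nil; apply/matrixP => a b; rewrite !mxE andbT.
  rewrite big_cons; case: ifP => ijk /=.
    rewrite IH ffunE [_ * _]coord_projM; apply: eq_coord_proj => a /=.
    by rewrite ijk.
  by rewrite IH; apply: eq_coord_proj => a /=; rewrite ijk.
rewrite -(rank_coord_proj (e_mono (ltnW ij)) (e_le j)).
congr (\rank _); apply: eq_coord_proj => a /=.
apply/hasP/idP => [[k _ /and3P[/andP[ik kj] ka ak]]|/andP[ia aj]].
  by rewrite (leq_trans _ ka) ?(leq_trans ak) // e_mono.
pose P t := [exists k : 'I_n, (k == t :> nat) && (e k <= a)%N].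
have [|t|t] := @ex_maxnP P j.
- by exists i; apply/existsP; exists i; rewrite eqxx.
- case/existsP => k /andP[/eqP <- ka]; rewrite leqNgt; apply/negP => jk.
  by have := e_mono (ltnW jk); rewrite leqNgt (leq_ltn_trans ka).
case/existsP => k /andP[/eqP <- {t} ka] kmax.
have kj : (k < j)%N.
  rewrite ltnNge; apply/negP => /e_mono.
  by rewrite leqNgt (leq_ltn_trans ka).
have ik : (i <= k)%N by apply: kmax; apply/existsP; exists i; rewrite eqxx.
have kn : (k < n.-1)%N by have := ltn_ord j; lia.
exists (Ordinal kn); first by rewrite mem_index_enum.
rewrite /= ik kj (_ : arrow_src _ = k) ?ka; last exact: val_inj.
rewrite ltnNge; apply/negP => h.
suff : (k.+1 <= k)%N by rewrite ltnn.
by apply: kmax; apply/existsP; exists (arrow_tgt (Ordinal kn)); rewrite h eqxx.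
Qed.

Lemma rank_base_change g (f : quiver_rep K n N) k :
  (forall i, g i \in unitmx) -> \rank (base_change g f k) = \rank (f k).
Proof.
move=> gu; rewrite ffunE mxrankMfree ?row_free_unit //.
by rewrite (eqmxMfull _ (_ : row_full (invmx _))) ?row_full_unit ?unitmx_inv.
Qed.

(** The function det (f_k + D), with D the projection onto the span of the v_b
    killed by the k-th arrow of the most degenerate representation, is
    polynomial in f and equals 1 at that representation.  It vanishes as soon as
    the corank of f_k exceeds the rank of D. *)
Lemma degeneration_corank f0 (O : quiver_rep K n N -> Prop) :
    (forall f, O f <-> orbit_of f0 f) ->
    degenerates_to O (rank_orbit (fun i j => N - e j + e i)%N) ->
  forall k, (N <= \rank (f0 k) + (e (arrow_tgt k) - e (arrow_src k)))%N.
Proof.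
move=> Of deg k; rewrite leqNgt; apply/negP => rk.
set p := e (arrow_src k) in rk *; set q := e (arrow_tgt k) in rk *.
have pq : (p <= q)%N by apply: e_mono => /=.
have qN : (q <= N)%N := e_le _.
pose D := coord_proj (fun a => ~~ (p <= a < q)%N).
have DE : 1%:M = coord_proj (fun a => p <= a < q)%N + D.
  apply/matrixP => a b; rewrite !mxE; case: (a == b); rewrite /= ?addr0 //.
  by case: (p <= a < q)%N; rewrite /= ?addr0 ?add0r.
have rD : (\rank D <= q - p)%N.
  have : coord_proj (fun a => p <= a < q)%N *m D = 0.
    rewrite coord_projM; apply/matrixP => a b; rewrite !mxE /=.
    by rewrite orbN andbF.
  move/mulmx0_rank_max; rewrite rank_coord_proj //.
  by lia.
pose x a b : 'I_#|{: 'I_n.-1 * 'I_N * 'I_N}| := enum_rank (k, a, b).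
(* The polynomial function f |-> det (f k + D). *)
pose P : {mpoly K[#|{: 'I_n.-1 * 'I_N * 'I_N}|]} :=
  \det (\matrix_(a, b) ('X_(x a b) + (D a b)%:MP)).
have PE f : P.@[rep_coords f] = \det (f k + D).
  rewrite /P -det_map_mx; congr (\det _); apply/matrixP => a b.
  by rewrite !mxE rmorphD /= mevalXU mevalC /rep_coords enum_rankK.
have := deg pbw_rep pbw_rep_orbit P; rewrite PE.
have -> : pbw_rep k + D = 1%:M by rewrite DE ffunE.
rewrite det1 => h; suff /eqP : (1 : K) = 0 by rewrite oner_eq0.
apply: h => f /Of[g gu ->]; rewrite PE.
apply/eqP; rewrite -[_ == 0]negbK -unitfE -unitmxE -row_free_unit.
rewrite -row_leq_rank -ltnNge (leq_ltn_trans (mxrank_add _ _)) //.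
by rewrite rank_base_change // (leq_ltn_trans _ rk) // leq_add2l.
Qed.

End Degeneration.

Section NatIndexed.
Variables (K : fieldType) (m N : nat) (e : 'I_m.+1 -> nat).

(** Dimensions and arrows are extended to all natural indices, constantly and by
    identities, so that recursions over the vertices need no side condition. *)
Definition dimn k := e (inord (minn k m)).
Definition arrown (f : quiver_rep K m.+1 N) (k : nat) : 'M[K]_N :=
  if insub k is Some j then f j else 1%:M.

Lemma dimnE (i : 'I_m.+1) : dimn i = e i.
Proof.
by congr e; apply: val_inj; rewrite /= (minn_idPl _) ?inordK // -ltnS.
Qed.

Lemma arrownE f (k : 'I_m) : arrown f k = f k.
Proof. by rewrite /arrown valK. Qed.

Lemma arrown_id f k : (m <= k)%N -> arrown f k = 1%:M.
Proof. by move=> mk; rewrite /arrown insubN // -leqNgt. Qed.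

Lemma dimn_src (k : 'I_m) : dimn k = e (arrow_src (k : 'I_m.+1.-1)).
Proof. by rewrite -dimnE. Qed.

Lemma dimn_tgt (k : 'I_m) : dimn k.+1 = e (arrow_tgt (k : 'I_m.+1.-1)).
Proof. by rewrite -dimnE. Qed.

Hypothesis (e_le : forall i, (e i <= N)%N)
  (e_mono : forall i j : 'I_m.+1, (i <= j)%N -> (e i <= e j)%N).

Lemma dimn_le k : (dimn k <= N)%N. Proof. exact: e_le. Qed.

Lemma dimn_mono k l : (k <= l)%N -> (dimn k <= dimn l)%N.
Proof.
move=> kl; apply: e_mono; rewrite !inordK ?ltnS ?geq_minr //.
by rewrite leq_min geq_minr andbT (leq_trans (geq_minl _ _)).
Qed.

Lemma normal_rep_exists (f : quiver_rep K m.+1 N) :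
    (forall k, (N <= \rank (f k) + (e (arrow_tgt k) - e (arrow_src k)))%N) ->
  exists2 M, orbit_of f M &
    forall k, normal_arrow (e (arrow_src k)) (e (arrow_tgt k)) (M k).
Proof.
move=> rf; pose F := arrown f.
pose comp := fix comp (k d : nat) : 'M[K]_N :=
  if d is d'.+1 then F k *m comp k.+1 d' else 1%:M.
have rF k : (N <= \rank (F k) + (dimn k.+1 - dimn k))%N.
  have [km|mk] := ltnP k m; last first.
    by rewrite /F arrown_id // mxrank1 leq_addr.
  have := rf (Ordinal km); rewrite -dimn_src -dimn_tgt.
  by rewrite -(arrownE f (Ordinal km)).
have rcomp d k : (N <= \rank (comp k d) + (dimn (k + d) - dimn k))%N.
  elim: d k => [|d IH] k /=; first by rewrite mxrank1 leq_addr.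
  have := mxrank_mul_min (F k) (comp k.+1 d).
  have := IH k.+1; have := rF k; rewrite addSnnS.
  have := dimn_mono (leqnSn k); have := @dimn_mono k.+1 (k + d.+1).
  by rewrite addnS ltnS leq_addr => /(_ isT); lia.
have [|||||g gu gN] := @normal_form K N m dimn F (fun k => comp k (m - k)%N).
- by move=> k; apply: dimn_mono.
- exact: dimn_le.
- exact: rF.
- move=> k; have [km|mk] := ltnP k m; first by rewrite -[in LHS](subnSK km).
  have -> : (m - k = 0)%N by lia.
  have -> : (m - k.+1 = 0)%N by lia.
  by rewrite /= mulmx1 /F arrown_id.
- move=> k; have [km|mk] := leqP k m; last first.
    by rewrite (_ : (m - k = 0)%N) ?mxrank1 ?dimn_le //; lia.
  have := rcomp (m - k)%N k; rewrite subnKC //.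
  by have := dimn_mono km; have := dimn_le m; lia.
exists (base_change (fun i : 'I_m.+1 => g i) f).
  by exists (fun i : 'I_m.+1 => g i) => // i; apply: gu; rewrite -ltnS.
move=> k; rewrite ffunE -(dimn_src k) -(dimn_tgt k) -(arrownE f k).
exact: gN.
Qed.

End NatIndexed.

(** * Columns and subsets *)

Section Columns.
Variables (n N : nat) (e : 'I_n -> nat).
Implicit Types c : pbw_column N e.

Lemma col_entry_inj c : pbw_column_ok c -> injective (col_entry c).
Proof.
by case/and3P => /tuple_uniqP ci _ _ i j; apply: ci.
Qed.

Lemma col_entry_own c i : pbw_column_ok c ->
  (col_entry c i < col_length c)%N -> col_entry c i = i :> nat.
Proof. by case/and3P => _ /forallP/(_ i)/implyP h _ /h/eqP. Qed.

Lemma col_entry_decr c i j : pbw_column_ok c ->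
  (col_length c <= col_entry c i)%N -> (col_length c <= col_entry c j)%N ->
  (i < j)%N -> (col_entry c j < col_entry c i)%N.
Proof.
case/and3P => _ _ /forallP/(_ i)/forallP/(_ j)/implyP h ci cj ij.
by apply: h; rewrite ci cj.
Qed.

Lemma col_setE c : col_set c = [set col_entry c i | i : 'I_(col_length c)].
Proof.
apply/setP => x; rewrite inE; apply/tnthP/imsetP => [[i ->]|[i _ ->]].
  by exists i.
by exists i.
Qed.

Lemma card_col_set c : pbw_column_ok c -> #|col_set c| = col_length c.
Proof.
by move=> ok; rewrite col_setE card_imset ?card_ord //; apply: col_entry_inj.
Qed.

(** Conditions (1) and (2) say that a column is determined by its set of
    entries: the entries below the length sit in their own row and the remaining
    rows are filled with the other entries in decreasing order. *)
Lemma pbw_column_exists i (I : {set 'I_N}) : #|I| = e i ->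
  exists c, [/\ pbw_column_ok c, tag c = i & col_set c = I].
Proof.
move=> cI; set p := e i in cI *.
have pN : (p <= N)%N by rewrite -cI -[N in X in (_ <= X)%N]card_ord max_card.
pose w (r : 'I_p) : 'I_N := widen_ord pN r.
pose M := [set r : 'I_p | w r \notin I].
pose k (r : 'I_p) := #|[set r' : 'I_p in M | (r' < r)%N]|.
pose ge (x y : 'I_N) := (y <= x)%N.
pose L := sort ge [seq x : 'I_N <- enum I | (p <= x)%N].
have Lu : uniq L by rewrite sort_uniq filter_uniq ?enum_uniq.
have Lmem x : (x \in L) = (x \in I) && (p <= x)%N.
  by rewrite mem_sort mem_filter mem_enum andbC.
have Ls : sorted ge L by apply: sort_sorted => x y; rewrite /ge leq_total.
(* There are as many large entries as rows left empty by the small ones. *)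
have sL : size L = #|M|.
  have -> : size L = #|[set x : 'I_N in I | (p <= x)%N]|.
    rewrite -(card_uniqP Lu); apply: eq_card => x.
    by rewrite Lmem inE.
  have := cardsC M; rewrite card_ord => cM.
  have : #|[set x : 'I_N in I | (x < p)%N]| = #|~: M|.
    rewrite -(card_imset _ (_ : injective w)); last first.
      by move=> r r' /(congr1 val)/= h; apply: val_inj.
    apply: eq_card => x; rewrite !inE; apply/andP/imsetP => [[xI xp]|[r]].
      have xE : x = w (Ordinal xp) by apply: val_inj.
      by exists (Ordinal xp); rewrite ?inE -?xE ?xI.
    by rewrite !inE negbK => rI ->; split=> //=.
  have : (#|[set x : 'I_N in I | (p <= x)%N]| + #|[set x : 'I_N in I | (x < p)%N]| = #|I|)%N.
    rewrite -cardsUI (_ : _ :&: _ = set0) ?cards0 ?addn0.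
      by apply: eq_card => x; rewrite !inE; case: (x \in I) => //=; rewrite leqNgt orbC orbN.
    by apply/setP => x; rewrite !inE; case: (x \in I); rewrite ?andbF //=; lia.
  by rewrite cI; lia.
have kM r : r \in M -> (k r < size L)%N.
  move=> rM; rewrite sL (cardsD1 r M) rM add1n ltnS.
  apply: subset_leq_card; apply/subsetP => r'; rewrite !inE => /andP[-> h].
  by rewrite andbT; apply: contraTneq h => ->; rewrite ltnn.
have k_lt (r r' : 'I_p) : r \in M -> (r < r')%N -> (k r < k r')%N.
  move=> rM rr'; apply: proper_card; apply/properP; split.
    apply/subsetP => s; rewrite !inE => /andP[-> h] /=.
    exact: ltn_trans h rr'.
  by exists r; rewrite !inE ?ltnn ?andbF // rr' andbT; rewrite inE in rM.
pose T r := if w r \in I then w r else nth (w r) L (k r).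
have TL r : r \in M -> T r = nth (w r) L (k r).
  by rewrite inE /T => /negPf ->.
have TI r : r \notin M -> T r = w r by rewrite inE negbK /T => ->.
have TM r : r \in M -> T r \in L by move=> rM; rewrite TL // mem_nth ?kM.
have Town r : (T r < p)%N -> T r = r :> nat.
  have [rM|rM] := boolP (r \in M); last by rewrite TI.
  by have := TM _ rM; rewrite Lmem => /andP[_]; lia.
have Tdecr r r' : (p <= T r)%N -> (p <= T r')%N -> (r < r')%N -> (T r' < T r)%N.
  move=> Tr Tr' rr'.
  have rM : r \in M by apply: contraLR Tr => /TI ->; rewrite -ltnNge /=.
  have rM' : r' \in M by apply: contraLR Tr' => /TI ->; rewrite -ltnNge /=.
  rewrite !TL // (set_nth_default (w r)) ?kM // ltn_neqAle; apply/andP; split.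
    rewrite (inj_eq val_inj) nth_uniq ?kM //.
    by rewrite neq_ltn (k_lt r r') ?orbT.
  have ge_trans : transitive ge.
    by move=> x y z; rewrite /ge => xy yz; apply: leq_trans yz xy.
  have ge_refl : reflexive ge by move=> x; rewrite /ge.
  have kk : (k r <= k r')%N by rewrite ltnW // (k_lt r r').
  have := sorted_leq_nth ge_trans ge_refl (w r) Ls; apply; rewrite ?inE ?kM //.
have Tinj : injective T.
  move=> r r' TT; apply: val_inj => /=; case: (ltnP (T r) p) => [h|h].
    by rewrite -(Town r) // TT (Town r') // -TT.
  have h' : (p <= T r')%N by rewrite -TT.
  case: (ltngtP r r') => // rr'.
    by have := Tdecr _ _ h h' rr'; rewrite TT ltnn.
  by have := Tdecr _ _ h' h rr'; rewrite TT ltnn.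
pose c : pbw_column N e := Tagged (fun i => (e i).-tuple 'I_N) [tuple T r | r < p].
have cE r : col_entry c r = T r by rewrite /col_entry tnth_mktuple.
exists c; split=> //.
  apply/and3P; split.
  - by rewrite map_inj_uniq ?enum_uniq.
  - by apply/forallP => r; apply/implyP; rewrite cE => /Town ->.
  - apply/forallP => r; apply/forallP => r'; apply/implyP.
    by rewrite !cE => /and3P[? ? ?]; apply: Tdecr.
apply/eqP; rewrite eqEcard col_setE; apply/andP; split.
  apply/subsetP => _ /imsetP[r _ ->]; rewrite cE.
  have [rM|rM] := boolP (r \in M); last by rewrite TI //; rewrite inE negbK in rM.
  by have := TM _ rM; rewrite Lmem => /andP[].
rewrite cI card_imset ?card_ord //.
by move=> r r'; rewrite !cE; apply: Tinj.
Qed.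

End Columns.

(** * A shuffle relation between minors *)

Section PluckerRelation.
Variables (K : fieldType) (N p q : nat).

Lemma det_by_columns m (A : 'M[K]_m) :
  \det A = \sum_(s : 'S_m) (-1) ^+ s * \prod_i A (s i) i.
Proof. by rewrite -det_tr; apply: eq_bigr => s _; under eq_bigr do rewrite mxE. Qed.

Lemma det_mul_wide (A : 'M[K]_(q.+1, q)) (B : 'M[K]_(q, q.+1)) :
  \det (A *m B) = 0.
Proof.
apply/eqP; apply: contraTT isT => d.
have : row_free (A *m B) by rewrite row_free_unit unitmxE unitfE.
rewrite -row_leq_rank => /leq_trans/(_ (mxrankM_maxl _ _)).
by move=> /leq_trans/(_ (rank_leq_col _)); rewrite ltnn.
Qed.

(** Multilinear expansion in the columns; keeping the sum over all functions k
    rather than over subsets avoids the signs of the Cauchy-Binet formula. *)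
Lemma det_mulmx_expand (u : 'M[K]_(p, N)) (G : 'M[K]_(N, p)) :
  \det (u *m G) = \sum_(k : {ffun 'I_p -> 'I_N})
    (\prod_s G (k s) s) * \det (\matrix_(a, s) u a (k s)).
Proof.
rewrite det_by_columns.
under eq_bigr => s _.
  under eq_bigr do rewrite mxE.
  rewrite bigA_distr_bigA /= mulr_sumr.
  over.
rewrite exchange_big; apply: eq_bigr => k _.
rewrite det_by_columns mulr_sumr; apply: eq_bigr => s _.
rewrite big_split /= mulrA mulrC; congr (_ * (_ * _)).
by apply: eq_bigr => i _; rewrite !mxE.
Qed.

Variables (i : 'I_p) (pq : (p <= q)%N).
Let iq : 'I_q := widen_ord pq i.
Let pq1 : (p <= q.+1)%N := leq_trans pq (leqnSn q).
(** The q.+1 shuffled slots are numbered so that the slots r <= i are the rows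
    r <= i of the right-hand column (low) and the slots r > i are the rows
    r - 1 >= i of the left-hand column (high). *)
Definition shuffle_low (s : 'I_p) : 'I_q.+1 := widen_ord pq1 s.
Definition shuffle_high (s : 'I_q) : 'I_q.+1 := lift (shuffle_low i) s.

Lemma val_shuffle_high (s : 'I_q) : (i <= s)%N -> shuffle_high s = s.+1 :> nat.
Proof. by rewrite /shuffle_high /= /bump => ->; rewrite add1n. Qed.

Lemma val_shuffle_high_lt (s : 'I_q) : (s < i)%N -> shuffle_high s = s :> nat.
Proof. by move=> si; rewrite /shuffle_high /= /bump leqNgt si. Qed.

Lemma big_shuffle (R : Type) (idx : R) (op : Monoid.com_law idx)
    (g : 'I_q.+1 -> R) :
  \big[op/idx]_r g r = op (\big[op/idx]_(s : 'I_p | (s <= i)%N) g (shuffle_low s))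
     (\big[op/idx]_(j : 'I_q | ~~ (j < i)%N) g (shuffle_high j)).
Proof.
rewrite (bigID (fun r : 'I_q.+1 => r <= i)%N) /=; congr (op _ _).
  rewrite (reindex_onto shuffle_low (fun r : 'I_q.+1 => insubd i (r : nat))).
    by apply: eq_bigl => j; rewrite /= valKd eqxx andbT.
  move=> r ri; apply: val_inj; rewrite /= val_insubd.
  by rewrite (leq_ltn_trans ri).
rewrite (reindex_onto shuffle_high (fun r : 'I_q.+1 => insubd iq r.-1)).
  apply: eq_bigl => j; have [ji|ij] := ltnP j i.
    by rewrite val_shuffle_high_lt // ltnW.
  by rewrite val_shuffle_high // valKd eqxx andbT -ltnNge ltnS ij.
move=> r ri; apply: val_inj; have ri' : (i < r)%N by rewrite ltnNge.
rewrite /shuffle_high /= /bump val_insubd.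
have -> : (r.-1 < q)%N by have := ltn_ord r; lia.
by have -> : (i <= r.-1)%N; lia.
Qed.

(** The rows of u *m F lie in the row space of w.  After expanding both
    determinants over permutations of their rows, the sum over s is the
    determinant of a square matrix of size q.+1 whose rows are all combinations
    of the q rows of w restricted to the columns theta, so it vanishes. *)
Lemma plucker_relation (w : 'M[K]_(q, N)) (u : 'M[K]_(p, N)) (F : 'M[K]_N)
    (C : 'M[K]_(p, q)) (theta : 'I_q.+1 -> 'I_N) (beta : 'I_q -> 'I_N)
    (alpha : 'I_p -> 'I_N) : u *m F = C *m w ->
  \sum_(s : 'S_q.+1) (-1) ^+ s
    * \det (\matrix_(a, j) w a (if (j < i)%N then beta j
                                else theta (s (shuffle_high j))))
    * \det (\matrix_(a, j) if (j <= i)%N then (u *m F) a (theta (s (shuffle_low j)))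
                           else u a (alpha j)) = 0.
Proof.
move=> uF.
pose Z (t : 'S_q) (t' : 'S_p) : 'M[K]_q.+1 := \matrix_(r, r')
  if (r <= i)%N then (u *m F) (t' (insubd i (r : nat))) (theta r')
  else w (t (insubd iq r.-1)) (theta r').
have Z0 t t' : \det (Z t t') = 0.
  pose E : 'M[K]_(q.+1, q) := \matrix_(r, a)
    if (r <= i)%N then C (t' (insubd i (r : nat))) a
    else (a == t (insubd iq r.-1))%:R.
  have -> : Z t t' = E *m (\matrix_(a, r') w a (theta r')).
    apply/matrixP => r r'; rewrite [LHS]mxE; case: ifP => ri.
      by rewrite uF !mxE; apply: eq_bigr => a _; rewrite !mxE ri.
    rewrite [RHS]mxE (bigD1 (t (insubd iq r.-1))) //= !mxE ri eqxx mul1r big1 ?addr0 //.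
    by move=> a /negPf ta; rewrite !mxE ri ta mul0r.
  exact: det_mul_wide.
(* The factors that do not involve s, and both row signs. *)
pose c (t : 'S_q) (t' : 'S_p) := (-1) ^+ t * (-1) ^+ t'
  * (\prod_(j < q | (j < i)%N) w (t j) (beta j))
  * (\prod_(j < p | ~~ (j <= i)%N) u (t' j) (alpha j)).
transitivity (\sum_(s : 'S_q.+1) \sum_(t : 'S_q) \sum_(t' : 'S_p)
   c t t' * ((-1) ^+ s * \prod_r Z t t' r (s r))); last first.
  rewrite exchange_big big1 // => t _; rewrite exchange_big big1 // => t' _.
  by rewrite -mulr_sumr -[X in _ * X]/(\det (Z t t')) Z0 mulr0.
apply: eq_bigr => s _; rewrite !det_by_columns -mulrA mulr_suml mulr_sumr.
apply: eq_bigr => t _; rewrite mulr_sumr mulr_sumr; apply: eq_bigr => t' _.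
rewrite [\prod_(_ < q) _](bigID (fun j : 'I_q => j < i)%N) /=.
rewrite [\prod_(_ < p) _](bigID (fun j : 'I_p => j <= i)%N) /=.
rewrite [\prod_(_ < q.+1) _]big_shuffle /=.
have -> : \prod_(j < q | (j < i)%N) (\matrix_(a, j0) w a (if (j0 < i)%N
     then beta j0 else theta (s (shuffle_high j0)))) (t j) j
   = \prod_(j < q | (j < i)%N) w (t j) (beta j).
  by apply: eq_bigr => j ji; rewrite mxE ji.
have -> : \prod_(j < p | ~~ (j <= i)%N) (\matrix_(a, j0) if (j0 <= i)%N
     then (u *m F) a (theta (s (shuffle_low j0))) else u a (alpha j0)) (t' j) j
   = \prod_(j < p | ~~ (j <= i)%N) u (t' j) (alpha j).
  by apply: eq_bigr => j /negPf ji; rewrite mxE ji.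
set A := \prod_(j < q | ~~ _) _; set B := \prod_(j < p | (_ <= _)%N) _.
have -> : \prod_(j < p | (j <= i)%N) Z t t' (shuffle_low j) (s (shuffle_low j)) = B.
  by apply: eq_bigr => j ji; rewrite !mxE /= valKd ji.
have -> : \prod_(j < q | ~~ (j < i)%N) Z t t' (shuffle_high j) (s (shuffle_high j)) = A.
  apply: eq_bigr => j ji; have ij : (i <= j)%N by rewrite leqNgt.
  by rewrite !mxE val_shuffle_high // (negPf ji) /= valKd.
rewrite /c; move: ((-1) ^+ s) ((-1) ^+ t) ((-1) ^+ t') => x y z.
by ring.
Qed.

Section ShuffleSign.
Variables (w : 'M[K]_(q, N)) (u : 'M[K]_(p, N)) (theta : 'I_q.+1 -> 'I_N).
Variables (beta : 'I_q -> 'I_N) (alpha : 'I_p -> 'I_N).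

Definition shuffle_left (s : 'S_q.+1) (j : 'I_q) : 'I_N :=
  if (j < i)%N then beta j else theta (s (shuffle_high j)).
Definition shuffle_right (s : 'S_q.+1) (j : 'I_p) : 'I_N :=
  if (j <= i)%N then theta (s (shuffle_low j)) else alpha j.

Definition shuffle_term (s : 'S_q.+1) : K := (-1) ^+ s
  * \det (\matrix_(a, j) w a (shuffle_left s j))
  * \det (\matrix_(a, j) u a (shuffle_right s j)).

Definition block_preserving (s : 'S_q.+1) :=
  [forall r, (s r <= i)%N == (r <= i)%N].

Lemma shuffle_splitP (r : 'I_q.+1) :
  (exists2 j : 'I_p, (j <= i)%N & r = shuffle_low j) \/
  (exists2 j : 'I_q, (i <= j)%N & r = shuffle_high j).
Proof.
have [ri|ri] := leqP r i; [left|right].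
  exists (insubd i (r : nat)); rewrite ?val_insubd ?(leq_ltn_trans ri) //.
  by apply: val_inj; rewrite /= val_insubd (leq_ltn_trans ri).
have rq : (r.-1 < q)%N by have := ltn_ord r; lia.
exists (Ordinal rq); first by rewrite /=; lia.
by apply: ord_inj; rewrite val_shuffle_high /=; lia.
Qed.

Lemma det_col_perm m (A : 'M[K]_m) (s : 'S_m) :
  \det (col_perm s A) = (-1) ^+ s * \det A.
Proof. by rewrite col_permE det_mulmx det_perm odd_permV mulrC. Qed.

Lemma shuffle_term_tperm (s : 'S_q.+1) (x y : 'I_q.+1) : x != y ->
  (x <= i)%N = (y <= i)%N -> shuffle_term (tperm x y * s)%g = shuffle_term s.
Proof.
move=> xy xyi; rewrite /shuffle_term odd_permM odd_tperm xy.
rewrite signr_addb /= expr1 mulN1r.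
case: (shuffle_splitP x) => -[a ai xE]; case: (shuffle_splitP y) => -[b bi yE].
- have -> : \matrix_(c, j) u c (shuffle_right (tperm x y * s)%g j) =
           col_perm (tperm a b) (\matrix_(c, j) u c (shuffle_right s j)).
    apply/matrixP => c j; rewrite !mxE /shuffle_right.
    have -> : (tperm a b j <= i)%N = (j <= i)%N.
      by case: tpermP => [->|->|//]; rewrite ai bi.
    case: ifP => ji; last first.
      by rewrite tpermD //; apply: contraFneq ji => <-.
    by rewrite permM xE yE -inj_tperm // => ? ? /(congr1 val)/= h; apply: val_inj.
  rewrite det_col_perm odd_tperm.
  have -> : a != b by apply: contraNneq xy => ab; rewrite xE yE ab.
  have -> : \matrix_(c, j) w c (shuffle_left (tperm x y * s)%g j) =
            \matrix_(c, j) w c (shuffle_left s j).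
    apply/matrixP => c j; rewrite !mxE /shuffle_left.
    case: ltnP => // ij; rewrite permM tpermD //.
      by apply/eqP => /(congr1 (@nat_of_ord _)); rewrite xE val_shuffle_high //=; lia.
    by apply/eqP => /(congr1 (@nat_of_ord _)); rewrite yE val_shuffle_high //=; lia.
  by rewrite expr1 mulN1r !mulNr mulrN opprK.
- by move: xyi; rewrite xE yE val_shuffle_high //= ai ltnNge bi.
- by move: xyi; rewrite xE yE val_shuffle_high //= bi ltnNge ai.
- have -> : \matrix_(c, j) w c (shuffle_left (tperm x y * s)%g j) =
           col_perm (tperm a b) (\matrix_(c, j) w c (shuffle_left s j)).
    apply/matrixP => c j; rewrite !mxE /shuffle_left.
    have -> : (tperm a b j < i)%N = (j < i)%N.
      by case: tpermP => [->|->|//]; rewrite !ltnNge ai bi.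
    case: ltnP => ij; rewrite ?permM ?xE ?yE.
      rewrite tpermD //; apply: contraTneq ij => <-; by rewrite -leqNgt.
    by rewrite -inj_tperm //; apply: lift_inj.
  rewrite det_col_perm odd_tperm.
  have -> : a != b by apply: contraNneq xy => ab; rewrite xE yE ab.
  have -> : \matrix_(c, j) u c (shuffle_right (tperm x y * s)%g j) =
            \matrix_(c, j) u c (shuffle_right s j).
    apply/matrixP => c j; rewrite !mxE /shuffle_right.
    case: ifP => // ji; rewrite permM tpermD //.
      by apply/eqP => /(congr1 (@nat_of_ord _)); rewrite xE val_shuffle_high //=; lia.
    by apply/eqP => /(congr1 (@nat_of_ord _)); rewrite yE val_shuffle_high //=; lia.
  by rewrite expr1 mulN1r mulrNN.
Qed.

(** Swapping two slots of the same block changes the sign of s and that of one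
    of the two minors.  By induction on the number of moved slots, multiplying
    by such a transposition reduces to the identity. *)
Lemma shuffle_sign s : block_preserving s -> shuffle_term s = shuffle_term 1%g.
Proof.
have [d] := ubnP #|[set r | s r != r]|; elim: d s => // d IH s sd sP.
have [/existsP[x sx]|/existsPn h] := boolP [exists x, s x != x]; last first.
  congr shuffle_term; apply/permP => x; rewrite perm1.
  by have := h x; rewrite negbK => /eqP.
pose y := (s^-1)%g x; have sy : s y = x by rewrite /y permKV.
have xy : x != y by apply/eqP => xy; rewrite -xy in sy; rewrite sy eqxx in sx.
have xyi : (x <= i)%N = (y <= i)%N.
  by have /eqP <- := forallP sP y; rewrite sy.
rewrite -(shuffle_term_tperm s xy xyi); apply: IH.
  rewrite -ltnS (leq_trans _ sd) // ltnS; apply: proper_card; apply/properP; split.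
    apply/subsetP => r; rewrite !inE permM; case: tpermP => [->|->|_ _ //].
      by rewrite sy eqxx.
    by rewrite sy.
  exists x; first by rewrite inE.
  by rewrite inE permM tpermL sy eqxx.
apply/forallP => r; rewrite permM; have /eqP -> := forallP sP (tperm x y r).
by case: tpermP => [->|->|//]; rewrite xyi.
Qed.

End ShuffleSign.
End PluckerRelation.

(** * Minors, columns and multidegrees *)

Section PluckerSign.
Variables (K : fieldType) (n N : nat) (e : 'I_n -> nat).
Hypothesis e_inj : injective e.

Definition minor p (b : seq 'rV[K]_N) (l : 'I_p -> 'I_N) : K :=
  \det (\matrix_(a < p, s < p) b`_a 0 (l s)).

Lemma minor_not_inj p b (l : 'I_p -> 'I_N) : ~ injective l -> minor b l = 0.
Proof.
move/injectiveP => /injectivePn[s [t st lst]]; rewrite /minor -det_tr.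
by apply: (determinant_alternate st) => a; rewrite !mxE lst.
Qed.

Lemma plucker_coord_minor p (I : {set 'I_N}) (l : 'I_p -> 'I_N) :
    injective l -> I = [set l s | s : 'I_p] ->
  exists eps : bool, forall b, plucker_coord b I = (-1) ^+ eps * minor b l.
Proof.
move=> li IE; have cI : p = #|I| by rewrite IE card_imset ?card_ord.
subst p; have lI s : l s \in I.
  have : l s \in [set l s | s : 'I_#|I|] by exact: imset_f.
  by rewrite -IE.
pose pi s := enum_rank_in (lI s) (l s).
have piE s : enum_val (pi s) = l s by rewrite enum_rankK_in.
have pi_inj : injective pi.
  by move=> s t st; apply: li; rewrite -!piE st.
exists (odd_perm (perm pi_inj)) => b; rewrite /minor.
have -> : \matrix_(a < #|I|, s < #|I|) b`_a 0 (l s) = col_perm (perm pi_inj)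
   (\matrix_(a < #|I|, c < #|I|) b`_a 0 (enum_val c)).
  by apply/matrixP => a s; rewrite !mxE permE piE.
by rewrite det_col_perm signrMK.
Qed.

Lemma column_var_eval c (b : forall i, (e i).-tuple 'rV[K]_N) :
    pbw_column_ok c ->
  (column_var K c).@[plucker_point b] = plucker_coord (b (tag c)) (col_set c).
Proof.
move=> ok; have cS := card_col_set ok.
have cC : #|col_set c| \in codom e by rewrite cS; exact: codom_f.
rewrite /column_var insubT /plucker_var mevalXU /plucker_point enum_rankK /=.
congr (plucker_coord (b _) _); apply: e_inj.
by rewrite /plucker_level f_iinv /= cS.
Qed.

(** A Plücker coordinate is the minor on the increasing enumeration of a set; the
    order of a PBW column differs from it by a permutation, whose sign is never
    needed explicitly. *)
Lemma column_minor c : pbw_column_ok c -> exists eps : bool,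
  forall b : (forall i, (e i).-tuple 'rV[K]_N),
   (column_var K c).@[plucker_point b]
     = (-1) ^+ eps * minor (b (tag c)) (col_entry c).
Proof.
move=> ok; have [eps epsP] := plucker_coord_minor (col_entry_inj ok) (col_setE c).
by exists eps => b; rewrite column_var_eval.
Qed.

Lemma minor_column i (l : 'I_(e i) -> 'I_N) : injective l ->
  exists c (eps : bool), [/\ pbw_column_ok c, tag c = i,
    col_set c = [set l s | s : 'I_(e i)] &
    forall b : (forall i, (e i).-tuple 'rV[K]_N),
      minor (b i) l = (-1) ^+ eps * (column_var K c).@[plucker_point b]].
Proof.
move=> li; have [|c [ok ci cl]] :=
  @pbw_column_exists _ N e i [set l s | s : 'I_(e i)].
  by rewrite card_imset ?card_ord.
have [eps epsP] := plucker_coord_minor li cl.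
exists c, eps; split=> // b; rewrite column_var_eval // ci epsP.
by rewrite mulrA -expr2 sqrr_sign mul1r.
Qed.

End PluckerSign.

Section Multihomogeneous.
Variables (K : fieldType) (n N : nat) (e : 'I_n -> nat).
Hypothesis e_inj : injective e.
Local Notation S := (plucker_ring K N e).

Definition homog_of (d : 'I_n -> nat) (p : S) :=
  forall m, m \in msupp p -> forall i, multidegree m i = d i.

Lemma homog_ofD d p q : homog_of d p -> homog_of d q -> homog_of d (p + q).
Proof.
by move=> hp hq m /msuppD_le; rewrite mem_cat => /orP[/hp|/hq].
Qed.

Lemma homog_ofZ d a p : homog_of d p -> homog_of d (a *: p).
Proof. by move=> hp m /msuppZ_le /hp. Qed.

(** The multidegree of a product of two Plücker coordinates of levels i and j. *)
Definition pair_degree (i j l : 'I_n) : nat := ((l == i) + (l == j))%N.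

Lemma column_var_pair c c' : pbw_column_ok c -> pbw_column_ok c' ->
  homog_of (pair_degree (tag c) (tag c')) (column_var K c * column_var K c').
Proof.
move=> ok ok'.
have varE d : pbw_column_ok d -> exists2 J : plucker_index N e,
    column_var K d = plucker_var K J & plucker_level J = tag d.
  move=> dok; have cS := card_col_set dok.
  have cC : #|col_set d| \in codom e by rewrite cS; exact: codom_f.
  exists (exist _ (col_set d) cC); first by rewrite /column_var insubT.
  by apply: e_inj; rewrite /plucker_level f_iinv /= cS.
have [J -> <-] := varE _ ok; have [J' -> <-] := varE _ ok'.
rewrite /plucker_var -mpolyXD => m; rewrite msuppX inE => /eqP -> i.
rewrite /multidegree; under eq_bigr do rewrite mnmDE !mnm1E.
have count (L : plucker_index N e) :
    (\sum_(I : plucker_index N e | plucker_level I == i)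
       (enum_rank L == enum_rank I) = (i == plucker_level L))%N.
  rewrite big_mkcond (bigD1 L) //= eqxx big1 ?addn0 => [|I IL].
    by rewrite eq_sym; case: eqP.
  by rewrite (inj_eq enum_rank_inj) [L == I]eq_sym (negPf IL); case: ifP.
by rewrite big_split /= !count.
Qed.

End Multihomogeneous.

(** * The staircase order on columns *)

Section Digits.
Local Open Scope nat_scope.

Lemma digits_bound B p (f : nat -> nat) : (forall k, k < p -> f k < B) ->
  \sum_(k < p) f k * B ^ k < B ^ p.
Proof.
elim: p => [|p IH] fB; first by rewrite big_ord0.
rewrite big_ord_recr /= expnSr mulnC.
have h1 := IH (fun k kp => fB k (ltnW kp)); have h2 := fB p (ltnSn p).
rewrite (leq_trans (_ : _ < B ^ p + B ^ p * f p)) ?ltn_add2r //.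
by rewrite -mulnS mulnC mulnC leq_mul2l h2 orbT.
Qed.

(** Comparison of two numbers in base B by their highest differing digit. *)
Lemma digits_lt B p (f g : nat -> nat) i : (forall k, k < p -> f k < B) ->
    i < p -> f i < g i -> (forall k, i < k < p -> f k <= g k) ->
  \sum_(k < p) f k * B ^ k < \sum_(k < p) g k * B ^ k.
Proof.
move=> fB; elim: p fB => // p IH fB ip fgi fg; rewrite !big_ord_recr /=.
move: ip; rewrite ltnS leq_eqVlt => /orP[/eqP ip|ip].
  have h := digits_bound (fun k kp => fB k (ltnW kp)).
  rewrite (leq_trans (_ : _ < B ^ p + f p * B ^ p)) ?ltn_add2r //.
  by rewrite -mulSn -ip (leq_trans _ (leq_addl _ _)) // leq_mul2r fgi orbT.
rewrite -addSn leq_add //.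
  apply: IH => // k kp; first by apply: fB; apply: ltnW.
  by case/andP: kp => ik kp; apply: fg; rewrite ik ltnW.
by rewrite leq_mul2r fg ?orbT // ip ltnSn.
Qed.

End Digits.

Section ColumnCode.
Variables (n N : nat) (e : 'I_n -> nat).
Implicit Types (c : pbw_column N e) (I : {set 'I_N}).

Definition window_card I (i b : nat) := #|[set x : 'I_N in I | (i <= x < b)%N]|.

(** For the set I of entries of a column of length p, the number of b such that
    fewer than p - i entries lie in the window [i, b) is the largest entry in
    the rows >= i, up to a shift.  Stating it by counting makes it depend on the
    set only, not on the arrangement of the column. *)
Definition stair p I (i : nat) :=
  #|[set b : 'I_N | (window_card I i b < p - i)%N]|.

Definition stair_code p I : nat := (\sum_(k < p) stair p I k * N.+1 ^ k)%N.

Definition set_weight p I := #|[set x : 'I_N in I | (x < p)%N]|.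

Lemma window_card_leq I i b b' : (b <= b')%N ->
  (window_card I i b <= window_card I i b')%N.
Proof.
move=> bb'; apply: subset_leq_card; apply/subsetP => x.
by rewrite !inE => /and3P[-> -> h]; rewrite (leq_trans h).
Qed.

(** Let b be the entry of row i.  The windows [j, b) with j >= i contain, of the
    old column, only entries in rows > i, and these are kept; the exchange puts
    one more entry k s0 in [i, b).  So the staircase cannot grow in rows
    >= i and strictly drops in row i, which decides the comparison since
    higher rows are more significant. *)
Lemma stair_code_exchange c (i : 'I_(col_length c))
    (k : 'I_(col_length c) -> 'I_N) (s0 : 'I_(col_length c)) :
    pbw_column_ok c -> (col_length c <= col_entry c i)%N -> injective k ->
    (forall s : 'I_(col_length c), (i < s)%N -> k s = col_entry c s) ->
    (s0 <= i)%N -> (i <= k s0 < col_entry c i)%N ->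
  (stair_code (col_length c) [set k s | s : 'I_(col_length c)]
    < stair_code (col_length c) (col_set c))%N.
Proof.
move=> ok; set p := col_length c in i k s0 *; set al := col_entry c.
set b := al i => pb ki kal s0i ks0.
have after (s : 'I_p) : (i < s)%N -> (s <= al s < b)%N.
  move=> si; have [h|h] := ltnP (al s) p.
    by rewrite (col_entry_own ok h) leqnn (leq_trans (ltn_ord s)).
  by rewrite (leq_trans (ltnW (ltn_ord s))) //= (col_entry_decr ok pb h si).
have before (s : 'I_p) : (s <= i)%N -> (al s < i)%N || (b <= al s)%N.
  rewrite leq_eqVlt => /orP[/eqP/val_inj ->|si]; first by rewrite leqnn orbT.
  have [h|h] := ltnP (al s) p; first by rewrite (col_entry_own ok h) si.
  by rewrite (ltnW (col_entry_decr ok h pb si)) orbT.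
move: (col_setE c); rewrite -/p -/al; move: (col_set c) => I IE; set I' := [set k s | s : 'I_p].
(* The rows >= j of k, with row i replaced by s0, have their entries in the
   window; there are p - j of them. *)
have cntI' j : (i <= j < p)%N -> (p - j <= window_card I' j b)%N.
  case/andP => ij jp.
  pose f (t : 'I_(p - j)) : 'I_p := if (j + t == i)%N then s0 else insubd i (j + t).
  have fE (t : 'I_(p - j)) : (j + t)%N != i -> f t = (j + t)%N :> nat.
    move=> ti; rewrite /f (negPf ti) val_insubd.
    by have -> : (j + t < p)%N by have := ltn_ord t; lia.
  have fs0 (t : 'I_(p - j)) : (j + t)%N = i -> f t = s0.
    by move=> ti; rewrite /f ti eqxx.
  rewrite -[X in (X <= _)%N]card_ord -(card_imset _ (_ : injective (k \o f))).
    apply: subset_leq_card; apply/subsetP => _ /imsetP[t _ ->].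
    rewrite inE; apply/andP; split; first exact: imset_f.
    rewrite /=; have [ti|/eqP ti] := eqVneq (j + t)%N i.
      rewrite fs0 //; case/andP: ks0 => h ->; rewrite andbT (leq_trans _ h) //.
      by lia.
    have ti' : (i < f t)%N by rewrite fE; [lia|apply/eqP].
    rewrite kal //; case/andP: (after _ ti') => h ->; rewrite andbT.
    by apply: leq_trans h; rewrite fE ?leq_addr //; apply/eqP.
  apply: inj_comp => // t t' ff; apply: ord_inj.
  have [ti|/eqP ti] := eqVneq (j + t)%N i; have [ti'|/eqP ti'] := eqVneq (j + t')%N i.
  - by lia.
  - by move: ff; rewrite fs0 // => /(congr1 (@nat_of_ord _)); rewrite fE; [lia|apply/eqP].
  - by move: ff; rewrite [f t']fs0 // => /(congr1 (@nat_of_ord _)); rewrite fE; [lia|apply/eqP].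
  - by move: ff => /(congr1 (@nat_of_ord _)); rewrite !fE; [lia|apply/eqP|apply/eqP].
have sub j (b' : 'I_N) : (i <= j < p)%N -> (window_card I' j b' < p - j)%N ->
    (window_card I j b' < p - j)%N.
  move=> ijp h; have b'b : (b' < b)%N.
    rewrite ltnNge; apply/negP => bb'.
    have := cntI' j ijp; rewrite leqNgt => /negP; apply.
    by rewrite (leq_ltn_trans (window_card_leq _ _ bb')).
  apply: leq_ltn_trans h; apply: subset_leq_card; apply/subsetP => x.
  rewrite !inE => /and3P[]; rewrite {1}IE => /imsetP[s _ ->] js sb'.
  rewrite js sb' !andbT; have [si|si] := leqP s i; last first.
    by rewrite -/p -/al -kal //; apply: imset_f.
  case/andP: ijp => ij _; case/orP: (before _ si) => h.
    by move: (leq_trans ij js); rewrite leqNgt h.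
  by move: (leq_trans sb' (ltnW b'b)); rewrite ltnNge h.
apply: (@digits_lt _ _ (stair p I') (stair p I) i) => //.
- by move=> j _; rewrite ltnS -[X in (_ <= X)%N](card_ord N) max_card.
- apply: proper_card; apply/properP; split.
    apply/subsetP => b'; rewrite !inE; apply: sub.
    by rewrite leqnn ltn_ord.
  exists b; last by rewrite inE -leqNgt cntI' // leqnn ltn_ord.
  rewrite inE; have ip := ltn_ord i.
  have : (window_card I i b <= #|[set al s | s : 'I_p & (i < s)%N]|)%N.
    apply: subset_leq_card; apply/subsetP => x.
    rewrite !inE => /and3P[]; rewrite {1}IE => /imsetP[s _ ->] js sb.
    apply: imset_f; rewrite inE ltnNge; apply/negP => /before.
    by rewrite ltnNge js leqNgt sb.
  move/leq_ltn_trans; apply; apply: leq_ltn_trans (leq_imset_card _ _) _.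
  have cE : #|[pred s : 'I_p | (i < s)%N]| = (p - i.+1)%N.
    rewrite -[RHS]card_ord -(card_imset _ (_ : injective
      (fun t : 'I_(p - i.+1) => insubd i (i.+1 + t) : 'I_p))).
      apply: eq_card => s; rewrite !inE; apply/idP/imsetP => [si|[t _ ->]].
        have sp : (s - i.+1 < p - i.+1)%N by have := ltn_ord s; lia.
        exists (Ordinal sp) => //; apply: ord_inj; rewrite val_insubd /=.
        by have -> : (i.+1 + (s - i.+1) < p)%N; have := ltn_ord s; lia.
      by rewrite val_insubd; case: ifP => h; have := ltn_ord t; lia.
    move=> t t' /(congr1 (@nat_of_ord _)); rewrite !val_insubd => h.
    by apply: ord_inj; move: h; have := ltn_ord t; have := ltn_ord t'; case: ifP; case: ifP; lia.
  rewrite (eq_card (_ : _ =i [pred s : 'I_p | (i < s)%N])) ?cE; first by lia.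
  by move=> s; rewrite !inE.
- move=> j /andP[ij jp]; apply: subset_leq_card; apply/subsetP => b'.
  by rewrite !inE; apply: sub; rewrite jp ltnW.
Qed.

End ColumnCode.

(** * Straightening two adjacent columns *)

Section Straightening.
Variables (K : numFieldType) (n N : nat) (e : 'I_n -> nat).
Hypothesis e_inj : injective e.
Implicit Types c d : pbw_column N e.
Local Notation bases := (forall i, (e i).-tuple 'rV[K]_N).
Local Notation var := (column_var K).

Definition col_weight c := set_weight (col_length c) (col_set c).
Definition col_code c := stair_code (col_length c) (col_set c).

(** The weight counts entries smaller than the length; it is the weight of the
    contracting one-parameter group.  The code of the left-hand column is
    allowed to grow. *)
Definition pair_smaller (d d' c c' : pbw_column N e) : Prop :=
  (col_weight d + col_weight d' < col_weight c + col_weight c')%N \/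
  ((col_weight d + col_weight d' = col_weight c + col_weight c')%N /\
   (col_code d' < col_code c')%N).

Definition exchange_pair c c' (d : pbw_column N e * pbw_column N e) : Prop :=
  [/\ pbw_column_ok d.1, pbw_column_ok d.2, tag d.1 = tag c, tag d.2 = tag c' &
      pair_smaller d.1 d.2 c c'].

Variables (c c' : pbw_column N e) (F : 'M[K]_N).
Hypotheses (okc : pbw_column_ok c) (okc' : pbw_column_ok c').
Let q := col_length c.
Let p := col_length c'.
Hypotheses (pq : (p <= q)%N) (nF : normal_arrow p q F).
Variable i : 'I_p.
Let al := col_entry c'.
Let be := col_entry c.
Hypothesis viol : forall s : 'I_q, (i <= s)%N -> (be s < al i)%N.
Let iq : 'I_q := widen_ord pq i.
Let low := shuffle_low pq.
Let high := shuffle_high i pq.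
Let theta (r : 'I_q.+1) : 'I_N :=
  if (r <= i)%N then al (insubd i (r : nat)) else be (insubd iq r.-1).

Let theta_low (s : 'I_p) : (s <= i)%N -> theta (low s) = al s.
Proof. by move=> si; rewrite /theta /= si valKd. Qed.

Let theta_high (s : 'I_q) : (i <= s)%N -> theta (high s) = be s.
Proof. by move=> si; rewrite /theta val_shuffle_high // ltnNge si /= valKd. Qed.

(** The violating entry exceeds the last entry of the left-hand column, which is
    at least q - 1. *)
Let b_ge_q : (q <= al i)%N.
Proof.
have q0 : (q.-1 < q)%N by have := ltn_ord iq; lia.
have iq1 : (i <= Ordinal q0)%N by have := ltn_ord iq; rewrite /=; lia.
have h := viol iq1; have [h'|h'] := ltnP (be (Ordinal q0)) q.
  by have := col_entry_own okc h' => /= E; move: h; rewrite /be E; lia.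
by rewrite ltnW // (leq_ltn_trans h').
Qed.

Let be_window (s : 'I_q) : (i <= s)%N -> (i <= be s < al i)%N.
Proof.
move=> si; rewrite viol // andbT; have [h|h] := ltnP (be s) q.
  by rewrite (col_entry_own okc h).
by rewrite (leq_trans _ h) // ltnW // (ltn_ord iq).
Qed.

Let al_before (s : 'I_p) : (s <= i)%N -> (al s < i)%N || (q <= al s)%N.
Proof.
rewrite leq_eqVlt => /orP[/eqP/val_inj ->|si]; first by rewrite b_ge_q orbT.
have [h|h] := ltnP (al s) p; first by rewrite (col_entry_own okc' h) si.
have hb : (p <= al i)%N by exact: leq_trans b_ge_q.
by rewrite (leq_trans b_ge_q) ?orbT // ltnW // (col_entry_decr okc' h hb si).
Qed.

Let left_ s := shuffle_left i pq theta be s.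
Let right_ s := shuffle_right i pq theta al s.
Let G (s : 'S_q.+1) : 'M[K]_(N, p) := \matrix_(x, j)
  if (j <= i)%N then F x (theta (s (low j))) else (x == al j)%:R.
Let coef (x : 'S_q.+1 * {ffun 'I_p -> 'I_N}) : K :=
  (-1) ^+ x.1 * \prod_j G x.1 (x.2 j) j.
(** The pairs (s, k) for which the exchange term is the original product. *)
Let main (x : 'S_q.+1 * {ffun 'I_p -> 'I_N}) :=
  block_preserving i x.1 && [forall j, x.2 j == right_ x.1 j].

(** A nonzero entry of F off the diagonal, or on it in a row between p and q,
    goes from a coordinate of weight 0 to one of weight 1; all other nonzero
    entries preserve the weight.  If no weight is lost then k is the list of
    exchanged entries itself. *)
Let exchange_weight s (k : 'I_p -> 'I_N) : injective (left_ s) -> injective k ->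
    (forall j, G s (k j) j != 0) ->
  let w := (set_weight q [set left_ s j | j : 'I_q]
            + set_weight p [set k j | j : 'I_p])%N in
  (w < col_weight c + col_weight c')%N \/
  (w = (col_weight c + col_weight c')%N /\ k =1 right_ s).
Proof.
move=> li ki Gk /=.
have wE r (l : 'I_r -> 'I_N) : injective l ->
    set_weight r [set l j | j : 'I_r] = (\sum_j (l j < r : nat))%N.
  move=> linj; rewrite /set_weight -sum1_card.
  rewrite (eq_bigl [pred x in [set l j | j : 'I_r] | (x < r)%N]); last first.
    by move=> x; rewrite !inE.
  rewrite big_imset_cond /=; last by move=> ? ? _ _; apply: linj.
  by rewrite big_mkcond; apply: eq_bigr => j _; case: (_ < _)%N.
have klast (j : 'I_p) : ~~ (j <= i)%N -> k j = al j.
  move=> ij; have := Gk j; rewrite mxE (negPf ij).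
  by have [//|_] := eqVneq (k j) (al j); rewrite eqxx.
have nF' (j : 'I_p) : (j <= i)%N -> k j = theta (s (low j)) \/
    (p <= k j)%N /\ (theta (s (low j)) < q)%N.
  move=> ji; have := Gk j; rewrite mxE ji.
  case: (boolP ((k j < p)%N || (q <= theta (s (low j)))%N)) => [h|].
    rewrite (nF h); have [E|_] := eqVneq (k j) (theta (s (low j))).
      by left.
    by rewrite eqxx.
  by rewrite negb_or -!leqNgt -!ltnNge => /andP[]; right.
pose E1 (j : 'I_p) : nat := (k j < p)%N.
pose E2 (j : 'I_p) : nat := (theta (s (low j)) < q)%N.
have E12 (j : 'I_p) : (j <= i)%N -> (E1 j <= E2 j ?= iff (E1 j == E2 j))%N.
  move=> ji; split=> //; rewrite /E1 /E2; case: ltnP => // kp.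
  by case: (nF' _ ji) => [<-|[_ ->]//]; rewrite (leq_trans kp).
have [E12s E12b] := leqif_sum E12.
have wl : (\sum_j (left_ s j < q : nat) =
    \sum_(j < q | (j < i)%N) (be j < q) +
    \sum_(j < q | ~~ (j < i)%N) (theta (s (high j)) < q))%N.
  rewrite (bigID (fun j : 'I_q => j < i)%N) /=; congr (_ + _)%N.
    by apply: eq_bigr => j ji; rewrite /left_ /shuffle_left ji.
  by apply: eq_bigr => j ji; rewrite /left_ /shuffle_left (negPf ji).
have wk : (\sum_j (k j < p : nat) =
    \sum_(j < p | (j <= i)%N) E1 j + \sum_(j < p | ~~ (j <= i)%N) (al j < p))%N.
  rewrite (bigID (fun j : 'I_p => j <= i)%N) /=; congr (_ + _)%N.
  by apply: eq_bigr => j ji; rewrite klast.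
have wt : (\sum_(j < p | (j <= i)%N) E2 j
      + \sum_(j < q | ~~ (j < i)%N) (theta (s (high j)) < q)
    = \sum_(j < p | (j <= i)%N) (al j < p)
      + \sum_(j < q | ~~ (j < i)%N) (be j < q))%N.
  transitivity (\sum_r (theta (s r) < q : nat))%N.
    by rewrite (big_shuffle i pq).
  rewrite [LHS](reindex_inj (@perm_inj _ (s^-1)%g)) /=.
  under eq_bigr do rewrite permKV.
  rewrite (big_shuffle i pq); congr (_ + _)%N; apply: eq_bigr => j ji.
    rewrite -/low theta_low //; congr (nat_of_bool _).
    case/orP: (al_before ji) => h; last by rewrite !ltnNge h (leq_trans pq h).
    by rewrite !(ltn_trans h) // (ltn_ord iq).
  by rewrite -/high theta_high // leqNgt.
have wc : (\sum_j (be j < q : nat) = \sum_(j < q | (j < i)%N) (be j < q)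
      + \sum_(j < q | ~~ (j < i)%N) (be j < q))%N.
  by rewrite (bigID (fun j : 'I_q => j < i)%N).
have wc' : (\sum_j (al j < p : nat) = \sum_(j < p | (j <= i)%N) (al j < p)
      + \sum_(j < p | ~~ (j <= i)%N) (al j < p))%N.
  by rewrite (bigID (fun j : 'I_p => j <= i)%N).
rewrite /col_weight !col_setE !wE //; try exact: col_entry_inj.
rewrite wl wk wc wc' {wl wk wc wc'}; move: E12s wt E12b.
move: (\sum_(j < p | (j <= i)%N) E1 j)%N (\sum_(j < p | (j <= i)%N) E2 j)%N
  (\sum_(j < q | ~~ (j < i)%N) (theta (s (high j)) < q))%N
  (\sum_(j < p | (j <= i)%N) (al j < p))%N
  (\sum_(j < p | ~~ (j <= i)%N) (al j < p))%N
  (\sum_(j < q | ~~ (j < i)%N) (be j < q))%N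
  (\sum_(j < q | (j < i)%N) (be j < q))%N => w1 w2 w3 w4 w5 w6 w7 E12s wt E12b.
have [E|NE] := eqVneq w1 w2; last by left; lia.
right; split; first by lia.
move=> j; rewrite /right_ /shuffle_right; case: ifP => ji; last first.
  by rewrite klast ?ji.
case: (nF' _ ji) => // -[kp tq].
move: E12b; rewrite E eqxx => /esym/forallP/(_ j)/implyP/(_ ji).
by rewrite /E1 /E2 tq ltnNge kp.
Qed.

Let not_block_preserving (s : 'S_q.+1) : ~~ block_preserving i s ->
  exists2 s0 : 'I_p, (s0 <= i)%N & (i < s (low s0))%N.
Proof.
move=> nbp; apply: boolp.contrapT => h; case/negP: nbp.
have hs (r : 'I_q.+1) : (r <= i)%N -> (s r <= i)%N.
  move=> ri; rewrite leqNgt; apply/negP => sr; apply: h.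
  have [[j ji rE]|[j ij rE]] := shuffle_splitP i pq r.
    by exists j; rewrite // -/(low j) -[low j]rE.
  by move: ri; rewrite rE val_shuffle_high // ltnNge ij.
pose L := [set r : 'I_q.+1 | (r <= i)%N].
have sL : s @: L = L.
  apply/eqP; rewrite eqEcard card_imset ?leqnn ?andbT; last exact: perm_inj.
  by apply/subsetP => _ /imsetP[r rL ->]; rewrite inE; apply: hs; rewrite inE in rL.
apply/forallP => r; apply/eqP; apply/idP/idP; last exact: hs.
move=> sr; have : s r \in L by rewrite inE.
by rewrite -sL => /imsetP[r' r'L /perm_inj ->]; rewrite inE in r'L.
Qed.

Let exchange_smaller (x : 'S_q.+1 * {ffun 'I_p -> 'I_N}) d d' : ~~ main x ->
    coef x != 0 -> injective (left_ x.1) -> injective x.2 ->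
    tag d = tag c -> tag d' = tag c' ->
    col_set d = [set left_ x.1 j | j : 'I_q] ->
    col_set d' = [set x.2 j | j : 'I_p] ->
  pair_smaller d d' c c'.
Proof.
move=> mx cx li ki td td' dE d'E.
have Gk j : G x.1 (x.2 j) j != 0.
  by apply: contraNneq cx => G0; rewrite /coef (bigD1 j) //= G0 mul0r mulr0.
have qE : col_length d = q by rewrite /col_length td.
have pE : col_length d' = p by rewrite /col_length td'.
have wd : col_weight d = set_weight q [set left_ x.1 j | j : 'I_q].
  by rewrite /col_weight qE dE.
have wd' : col_weight d' = set_weight p [set x.2 j | j : 'I_p].
  by rewrite /col_weight pE d'E.
rewrite /pair_smaller wd wd'.
have /= [h|[h kE]] := exchange_weight li ki Gk; [by left|right]; split=> //.
have /not_block_preserving[s0 s0i ss0] : ~~ block_preserving i x.1.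
  by apply: contra mx => bp; rewrite /main bp; apply/forallP => j; rewrite kE.
rewrite /col_code pE d'E.
have pb : (p <= al i)%N := leq_trans pq b_ge_q.
apply: (@stair_code_exchange n N e c' i x.2 s0) => //.
  by move=> j ij; rewrite kE /right_ /shuffle_right leqNgt ij.
rewrite kE /right_ /shuffle_right s0i -/low.
have [[j ji rE]|[j ij rE]] := shuffle_splitP i pq (x.1 (low s0)).
  by move: ss0; rewrite rE /= ltnNge ji.
by rewrite rE -/high theta_high // be_window.
Qed.

Let other_terms x : ~~ main x -> exists r : seq (K * (pbw_column N e * pbw_column N e)),
  (forall y, y \in r -> exchange_pair c c' y.2) /\
  forall b : bases, coef x * minor (b (tag c)) (left_ x.1) * minor (b (tag c')) x.2
    = \sum_(y <- r) y.1 * ((var y.2.1).@[plucker_point b]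
                           * (var y.2.2).@[plucker_point b]).
Proof.
move=> mx.
have triv : (forall b : bases, coef x * minor (b (tag c)) (left_ x.1)
      * minor (b (tag c')) x.2 = 0) ->
    exists r : seq (K * (pbw_column N e * pbw_column N e)),
  (forall y, y \in r -> exchange_pair c c' y.2) /\
  forall b : bases, coef x * minor (b (tag c)) (left_ x.1) * minor (b (tag c')) x.2
    = \sum_(y <- r) y.1 * ((var y.2.1).@[plucker_point b]
                           * (var y.2.2).@[plucker_point b]).
  by move=> h; exists [::]; split=> // b; rewrite big_nil h.
have [c0|c0] := eqVneq (coef x) 0; first by apply: triv => b; rewrite c0 !mul0r.
have [li|li] := boolp.pselect (injective (left_ x.1)); last first.
  by apply: triv => b; rewrite (minor_not_inj _ li) mulr0 mul0r.
have [ki|ki] := boolp.pselect (injective x.2); last first.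
  by apply: triv => b; rewrite (minor_not_inj _ ki) mulr0.
have [d [ep [dok dt dE dP]]] := minor_column K e_inj (i := tag c) li.
have [d' [ep' [dok' dt' dE' dP']]] := minor_column K e_inj (i := tag c') ki.
exists [:: (coef x * (-1) ^+ ep * (-1) ^+ ep', (d, d'))]; split.
  move=> y; rewrite inE => /eqP -> /=; split=> //=.
  exact: exchange_smaller mx c0 li ki _ _ _ _.
move=> b; rewrite big_seq1 /= dP dP'.
by ring.
Qed.

Let main_terms x (b : bases) : main x ->
  coef x * minor (b (tag c)) (left_ x.1) * minor (b (tag c')) x.2
  = minor (b (tag c)) be * minor (b (tag c')) al.
Proof.
case: x => s k /andP[/= bp /forallP kE].
have {}kE : k =1 right_ s by move=> j; apply/eqP.
have kE' : minor (b (tag c')) k = minor (b (tag c')) (right_ s).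
  by congr (\det _); apply/matrixP => a j; rewrite !mxE kE.
have G1 : \prod_j G s (k j) j = 1.
  rewrite big1 // => j _; rewrite mxE kE /right_ /shuffle_right.
  case ji: (j <= i)%N; last by rewrite eqxx.
  have [[j' ji' rE]|[j' ij rE]] := shuffle_splitP i pq (s (low j)).
    rewrite -/low rE -/low theta_low // nF ?eqxx //.
    case/orP: (al_before ji') => [h|->]; last by rewrite orbT.
    by rewrite (ltn_trans h).
  have /eqP := forallP bp (low j); rewrite rE val_shuffle_high // [X in _ = X]/= ji.
  by rewrite ltnNge ij.
rewrite /coef /= G1 mulr1 kE'.
transitivity (shuffle_term i pq (\matrix_(a < q) (b (tag c))`_a)
   (\matrix_(a < p) (b (tag c'))`_a) theta be al s).
  rewrite /shuffle_term /minor; congr (_ * _ * _); congr (\det _);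
    by apply/matrixP => a j; rewrite !mxE.
rewrite shuffle_sign // /shuffle_term odd_perm1 mul1r /minor.
congr (_ * _); congr (\det _); apply/matrixP => a j; rewrite !mxE;
  congr (_ _ _).
  rewrite /shuffle_left; case: ltnP => // ij; rewrite perm1.
  exact: theta_high.
rewrite /shuffle_right; case: leqP => // ij; rewrite perm1.
exact: theta_low.
Qed.

Let term x (b : bases) : K :=
  coef x * minor (b (tag c)) (left_ x.1) * minor (b (tag c')) x.2.

Let terms_relation (b : bases) (C : 'M[K]_(p, q)) :
    (\matrix_(a < p) (b (tag c'))`_a) *m F = C *m (\matrix_(a < q) (b (tag c))`_a) ->
  \sum_x term x b = 0.
Proof.
move=> uF; have := plucker_relation i pq theta be al uF.
move=> R; rewrite -[RHS]R {R} -(pair_big xpredT xpredT (fun s k => term (s, k) b)) /=.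
apply: eq_bigr => s _.
have -> : \matrix_(a, j) (if (j <= i)%N
      then (\matrix_(a < p) (b (tag c'))`_a *m F) a (theta (s (shuffle_low pq j)))
      else (\matrix_(a < p) (b (tag c'))`_a) a (al j))
    = (\matrix_(a < p) (b (tag c'))`_a) *m G s.
  apply/matrixP => a j; rewrite [LHS]mxE; case: ifP => ji.
    by rewrite !mxE; apply: eq_bigr => x _; rewrite !mxE ji.
  rewrite [RHS]mxE (bigD1 (al j)) //= big1 ?addr0 => [|x xj].
    by rewrite [G s _ _]mxE ji eqxx mulr1.
  by rewrite [G s _ _]mxE ji (negPf xj) mulr0.
rewrite det_mulmx_expand mulr_sumr; apply: eq_bigr => k _.
rewrite /term /coef /= -!mulrA; congr (_ * _); rewrite mulrCA.
congr (_ * (_ * _)); congr (\det _); apply/matrixP => a j; rewrite !mxE //.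
Qed.

Variable M : quiver_rep K n N.
Hypothesis FM : forall U, quiver_grassmannian e M U ->
  forall v, v \in U (tag c') -> v *m F \in U (tag c).

(** The sum of the exchange terms vanishes on the quiver Grassmannian; the main
    terms are all equal, their number is nonzero in characteristic zero, and
    they are moved to the other side. *)
Lemma straighten_violation : exists r : seq (K * (pbw_column N e * pbw_column N e)),
  (forall y, y \in r -> exchange_pair c c' y.2) /\
  var c * var c' - \sum_(y <- r) y.1 *: (var y.2.1 * var y.2.2)
    \in @vanishing_ideal K n N e M.
Proof.
have [r [rP rE]] : exists r : seq (K * (pbw_column N e * pbw_column N e)),
  (forall y, y \in r -> exchange_pair c c' y.2) /\
  forall b : bases, \sum_(x | ~~ main x) term x b
    = \sum_(y <- r) y.1 * ((var y.2.1).@[plucker_point b]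
                           * (var y.2.2).@[plucker_point b]).
  rewrite /index_enum; elim: (Finite.enum _) => [|x xs [r [rP rE]]].
    by exists [::]; split=> // b; rewrite !big_nil.
  have [mx|mx] := boolP (main x).
    by exists r; split=> // b; rewrite big_cons mx /= rE.
  have [r' [r'P r'E]] := other_terms mx.
  exists (r' ++ r); split=> [y|b]; first by rewrite mem_cat => /orP[/r'P|/rP].
  by rewrite big_cons mx /= rE big_cat /= -r'E.
pose m := #|[pred x | main x]|.
have m0 : m%:R != 0 :> K.
  rewrite pnatr_eq0 -lt0n; apply/card_gt0P.
  exists (1%g, [ffun j => right_ 1%g j]); rewrite inE /main /=.
  apply/andP; split; apply/forallP => j; first by rewrite perm1 eqxx.
  by rewrite ffunE eqxx.
have [ep epP] := column_minor K e_inj okc.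
have [ep' ep'P] := column_minor K e_inj okc'.
(* Both signs are their own inverses. *)
pose z : K := - (-1) ^+ ep * (-1) ^+ ep' / m%:R.
pose r1 := [seq (z * y.1, y.2) | y <- r].
exists r1; split; first by move=> _ /mapP[y yr ->]; exact: (rP _ yr).
set D := _ - _; apply/boolp.asboolP; exists [:: (1, D)]; last first.
  by rewrite big_seq1 mul1r.
move=> _ /[!inE] /eqP -> /=; split.
  exists (pair_degree (tag c) (tag c')).
  have h : homog_of (pair_degree (tag c) (tag c')) (\sum_(y <- r1) y.1 *: (var y.2.1 * var y.2.2)).
    rewrite big_seq; elim/big_ind: _ => [k|u v|y0]; first by rewrite msupp0.
      exact: homog_ofD.
    case/mapP=> y /rP[ok1 ok2 t1 t2 _] -> /=; apply: homog_ofZ.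
    by rewrite -t1 -t2; apply: column_var_pair.
  rewrite /D -scaleN1r; apply: homog_ofD; last exact: homog_ofZ.
  exact: column_var_pair.
move=> U UM b bU; rewrite /D mevalB mevalM.
have -> : (\sum_(y <- r1) y.1 *: (var y.2.1 * var y.2.2)).@[plucker_point b]
  = z * \sum_(x | ~~ main x) term x b.
  rewrite rE mulr_sumr raddf_sum big_map; apply: eq_bigr => y _ /=.
  by rewrite mevalZ mevalM mulrA.
have T0 : \sum_x term x b = 0.
  apply: (@terms_relation b (\matrix_(a, a') coord (b (tag c)) a'
    ((b (tag c'))`_a *m F))).
  apply/row_matrixP => a; rewrite !row_mul !rowK.
  have bc := bU (tag c); have bc' := bU (tag c').
  have /(FM UM) : (b (tag c'))`_a \in U (tag c').
    by apply: (basis_mem bc'); rewrite mem_nth // size_tuple.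
  rewrite -(span_basis bc) => /coord_span {1}->.
  rewrite [RHS]mulmx_sum_row; apply: eq_bigr => a' _.
  by rewrite !mxE rowK.
have Tm : \sum_(x | main x) term x b
   = m%:R * (minor (b (tag c)) be * minor (b (tag c')) al).
  rewrite (eq_bigr (fun=> minor (b (tag c)) be * minor (b (tag c')) al)).
    by rewrite sumr_const mulr_natl.
  by move=> x /main_terms; apply.
have := T0; rewrite (bigID main) /= Tm => /eqP; rewrite addrC addr_eq0 => /eqP ->.
rewrite epP ep'P /z -/be -/al.
by field.
Qed.
End Straightening.

(** * Semi-standard monomials span *)

Lemma sortedPn (T : Type) (r : rel T) (s : seq T) : ~~ sorted r s ->
  exists s1 x y s2, s = s1 ++ x :: y :: s2 /\ ~~ r x y.
Proof.
elim: s => // x [|y s] IH //=; rewrite negb_and.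
have [rxy|rxy _] := boolP (r x y) => /=; last by exists [::], x, y, s.
by case/IH=> s1 [x' [y' [s2 [-> h]]]]; exists (x :: s1), x', y', s2.
Qed.

Section Spanning.
Variables (K : numFieldType) (n N : nat) (e : 'I_n -> nat).
Hypothesis e_mono : forall i j : 'I_n, (i < j)%N -> (e i < e j)%N.
Variable M : quiver_rep K n N.
Hypothesis nM : forall k,
  normal_arrow (e (arrow_src k)) (e (arrow_tgt k)) (M k).
Local Notation var := (column_var K).
Local Notation col := (pbw_column N e).
Local Notation pi := (@coord_pi K n N e M).

Lemma dimension_inj : injective e.
Proof.
move=> i j eij; apply: ord_inj.
by case: (ltngtP i j) => // /e_mono; rewrite eij ltnn.
Qed.

Lemma dimension_le (i j : 'I_n) : (e i <= e j)%N -> (i <= j)%N.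
Proof. by apply: contraTT; rewrite -!ltnNge; apply: e_mono. Qed.

Lemma dimension_mono (i j : 'I_n) : (i <= j)%N -> (e i <= e j)%N.
Proof.
by rewrite leq_eqVlt => /orP[/eqP/ord_inj->//|/e_mono/ltnW].
Qed.

Lemma path_map (i j : 'I_n) : (i <= j)%N -> exists2 F : 'M[K]_N,
  normal_arrow (e i) (e j) F & forall U, quiver_grassmannian e M U ->
    forall v, v \in U i -> v *m F \in U j.
Proof.
move=> ij; have [d dE] : exists d, (i + d = j)%N by exists (j - i)%N; lia.
elim: d i {ij} dE => [|d IH] i dE.
  have -> : j = i by apply: ord_inj; lia.
  by exists 1%:M => [|U _ v]; [apply: normal_arrow1|rewrite mulmx1].
have ki : (i < n.-1)%N by have := ltn_ord j; lia.
pose k : 'I_n.-1 := Ordinal ki.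
have ks : arrow_src k = i by apply: ord_inj.
have [|F nF FU] := IH (arrow_tgt k); first by rewrite /=; lia.
exists (M k *m F) => [|U UM v vU].
  have nMk := @nM k; rewrite ks in nMk; apply: normal_arrow_comp nMk nF.
    by apply: dimension_mono; rewrite /= leqnSn.
  by apply: dimension_mono; rewrite /=; lia.
rewrite mulmxA; apply: FU => //; have [_ MU] := UM; apply: MU.
by rewrite ks.
Qed.

Lemma straighten (c c' : col) : pbw_column_ok c -> pbw_column_ok c' ->
    (col_length c' <= col_length c)%N -> ~~ pbw_next c c' ->
  exists r : seq (K * (col * col)),
    (forall y, y \in r -> exchange_pair c c' y.2) /\
    var c * var c' - \sum_(y <- r) y.1 *: (var y.2.1 * var y.2.2)
      \in @vanishing_ideal K n N e M.
Proof.
move=> ok ok' le; rewrite /pbw_next le /= => /forallPn[i /existsPn ni].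
have [F nF FU] := path_map (dimension_le le).
apply: (@straighten_violation K n N e dimension_inj c c' F ok ok' le nF i).
  by move=> s si; have := ni s; rewrite si /= -ltnNge.
exact: FU.
Qed.

Definition col_mon (T : seq col) : plucker_ring K N e := \prod_(c <- T) var c.

Definition spanned (p : plucker_ring K N e) : Prop :=
  exists s : seq (K * pbw_tableau N e),
    pi p = \sum_(x <- s) x.1 *: pi (pbw_monomial K x.2).

Lemma coord_pi0 : pi 0 = 0.
Proof. by apply: (addrI (pi 0)); rewrite -coord_piD !addr0. Qed.

Lemma coord_pi_sum (T : Type) (s : seq T) (F : T -> plucker_ring K N e) :
  pi (\sum_(x <- s) F x) = \sum_(x <- s) pi (F x).
Proof. exact: (big_morph _ (coord_piD M) coord_pi0). Qed.

Lemma spanned_sum (T : eqType) (s : seq T) (a : T -> K) F :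
  (forall x, x \in s -> spanned (F x)) -> spanned (\sum_(x <- s) a x *: F x).
Proof.
elim: s => [|x s IH] h.
  by exists [::]; rewrite !big_nil coord_pi0.
have [s1 s1E] : spanned (F x) by apply: h; rewrite mem_head.
have [|s2 s2E] := IH; first by move=> y ys; apply: h; rewrite in_cons ys orbT.
exists ([seq (a x * y.1, y.2) | y <- s1] ++ s2).
rewrite big_cons coord_piD s2E big_cat big_map; congr (_ + _).
have -> : pi (a x *: F x) = a x *: pi (F x) by exact: coord_piZ.
rewrite s1E scaler_sumr.
by apply: eq_bigr => y _; rewrite scalerA.
Qed.

Lemma spanned_ideal p p' : p - p' \in @vanishing_ideal K n N e M ->
  spanned p' -> spanned p.
Proof. by rewrite -coord_piP => /eqP pp' [s sE]; exists s; rewrite pp'. Qed.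

Definition tab_weight (T : seq col) : nat := (\sum_(c <- T) col_weight c)%N.
Definition tab_code (T : seq col) : nat :=
  foldr (fun c v => (col_code c + N.+1 ^ N * v)%N) 0%N T.
Definition by_length := fun c c' : col => (col_length c' <= col_length c)%N.

Lemma col_code_bound (c : col) : pbw_column_ok c -> (col_code c < N.+1 ^ N)%N.
Proof.
move=> ok; have pN : (col_length c <= N)%N.
  by rewrite -(card_col_set ok) -[N in X in (_ <= X)%N]card_ord max_card.
have h : (col_code c < N.+1 ^ col_length c)%N.
  apply: digits_bound => k _.
  by rewrite ltnS -[X in (_ <= X)%N](card_ord N) max_card.
by rewrite (leq_trans h) // leq_pexp2l.
Qed.

(** Induction on the weight, then on [tab_code], in which columns further to the
    right are more significant: a straightening step lowers the code of the
    right-hand column of the pair and only disturbs the column before it. *)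
Lemma col_mon_spanned (T : seq col) :
  all (@pbw_column_ok n N e) T -> sorted by_length T -> spanned (col_mon T).
Proof.
have [w] := ubnP (tab_weight T); elim: w T => // w IHw T.
have [v] := ubnP (tab_code T); elim: v T => // v IHv T.
move=> Tv Tw Tok Tl; have [Ts|] := boolP (sorted (@pbw_next n N e) T).
  have Tss : pbw_semistandard T by rewrite /pbw_semistandard Tok.
  by exists [:: (1, exist _ T Tss)]; rewrite big_seq1 scale1r.
case/sortedPn => T1 [c [c' [T2 [TE ncc']]]].
have [okc okc'] : pbw_column_ok c /\ pbw_column_ok c'.
  by move: Tok; rewrite TE all_cat /= => /and4P[].
have lcc' : (col_length c' <= col_length c)%N.
  by move: Tl; rewrite TE => /cat_sorted2[_] /= /andP[].
have [r [rP rI]] := straighten okc okc' lcc' ncc'.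
pose T' (y : col * col) := T1 ++ y.1 :: y.2 :: T2.
apply: (@spanned_ideal _ (\sum_(y <- r) y.1 *: col_mon (T' y.2))).
  have -> : col_mon T - \sum_(y <- r) y.1 *: col_mon (T' y.2)
    = col_mon T1 * col_mon T2 *
      (var c * var c' - \sum_(y <- r) y.1 *: (var y.2.1 * var y.2.2)).
    rewrite mulrBr mulr_sumr TE; congr (_ - _).
      by rewrite /col_mon big_cat !big_cons /=; ring.
    apply: eq_bigr => y _; rewrite -scalerAr /T' /col_mon big_cat !big_cons /=.
    by congr (_ *: _); ring.
  exact: vanishing_idealMr.
apply: spanned_sum => y /rP[ok1 ok2 t1 t2 sm].
have T'ok : all (@pbw_column_ok n N e) (T' y.2).
  by move: Tok; rewrite TE !all_cat /= ok1 ok2 okc okc'.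
have T'l : sorted by_length (T' y.2).
  have lE S : sorted by_length S = sorted geq (map (@col_length n N e) S).
    by rewrite sorted_map.
  have := Tl; rewrite !lE TE.
  by rewrite /T' !map_cat /= /col_length t1 t2.
have Wcat (S1 S2 : seq col) : tab_weight (S1 ++ S2) = (tab_weight S1 + tab_weight S2)%N.
  by rewrite /tab_weight big_cat.
have Wcons d (S : seq col) : tab_weight (d :: S) = (col_weight d + tab_weight S)%N.
  by rewrite /tab_weight big_cons.
have WT : (tab_weight T = tab_weight T1 + (col_weight c + col_weight c') + tab_weight T2)%N.
  by rewrite TE Wcat !Wcons !addnA.
have WT' : (tab_weight (T' y.2) = tab_weight T1 +
    (col_weight y.2.1 + col_weight y.2.2) + tab_weight T2)%N.
  by rewrite Wcat !Wcons !addnA.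
case: sm => [sm|[sm1 sm2]].
  apply: IHw; rewrite // WT' -ltnS (leq_trans _ Tw) // ltnS WT.
  by rewrite ltn_add2r ltn_add2l.
apply: IHv => //; last by rewrite WT' sm1 -WT.
rewrite -ltnS (leq_trans _ Tv) // ltnS TE /T'.
elim: T1 {TE WT WT' T' T'ok T'l rP rI} => [|d T1 IH] /=; last first.
  by rewrite ltn_add2l ltn_mul2l expn_gt0 /= IH.
have := col_code_bound ok1; move: (N.+1 ^ N)%N (tab_code T2) => B t hB.
rewrite !mulnDr !addnA ltn_add2r (leq_trans (_ : _ < B + B * col_code y.2.2)%N) //.
  by rewrite ltn_add2r.
by rewrite -mulnS (leq_trans _ (leq_addl _ _)) // leq_mul2l sm2 orbT.
Qed.

Lemma monomial_spanned m : spanned 'X_[m].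
Proof.
have colP (J : plucker_index N e) : exists c : col, pbw_column_ok c /\ col_set c = val J.
  have /codomP[i iE] := valP J.
  by have [c [ok _ cJ]] := pbw_column_exists iE; exists c.
have [f fP] := boolp.choice colP.
pose T := flatten [seq nseq (m (enum_rank J)) (f J) | J <- index_enum (plucker_index N e)].
have Tok : all (@pbw_column_ok n N e) T.
  apply/allP => c /flattenP[_ /mapP[J _ ->]]; rewrite mem_nseq => /andP[_ /eqP ->].
  by case: (fP J).
have fvar J : var (f J) = plucker_var K J.
  have [_ fJ] := fP J; rewrite /column_var fJ.
  by rewrite valK.
have -> : 'X_[m] = col_mon (sort by_length T).
  rewrite /col_mon (perm_big T) ?perm_sort //= big_flatten big_map mpolyXE_id.
  rewrite (reindex_onto enum_rank enum_val) /=; last by move=> t _; rewrite enum_valK.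
  rewrite (eq_bigl xpredT); last by move=> J; rewrite enum_rankK eqxx.
  apply: eq_bigr => J _; rewrite big_nseq fvar /plucker_var.
  by elim: (m _) => [|k IH]; rewrite ?expr0 // exprS IH iterS.
apply: col_mon_spanned; first by rewrite all_sort.
by apply: sort_sorted => c c'; rewrite /by_length leq_total.
Qed.

Lemma pbw_monomials_span (v : coordinate_ring e M) : exists s c,
  v = \sum_(j <- s) c j *: pi (pbw_monomial K j).
Proof.
have : spanned (generic_quotient.repr v).
  rewrite [generic_quotient.repr v]mpolyE; apply: spanned_sum => m _; exact: monomial_spanned.
case=> l; have -> : pi (generic_quotient.repr v) = v by exact: coord_repr.
move=> ->; exists (undup (map snd l)), (fun j => \sum_(x <- l | x.2 == j) x.1).
under [RHS]eq_bigr do rewrite scaler_suml.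
rewrite (exchange_big_dep xpredT) //= big_seq [RHS]big_seq.
apply: eq_bigr => x xl; under eq_bigl do rewrite eq_sym.
by rewrite -big_filter filter_pred1_uniq ?undup_uniq ?mem_undup ?map_f // big_seq1.
Qed.

End Spanning.

(** * Independence and leading terms *)

Section Independence.
Variables (K : numFieldType) (J : eqType).

Definition lin_indep (X : Type) (D : X -> Prop) (F : J -> X -> K) : Prop :=
  forall (s : seq J) (c : J -> K), uniq s ->
    (forall x, D x -> \sum_(j <- s) c j * F j x = 0) ->
  forall j, j \in s -> c j = 0.

(** Dedekind's argument: comparing a relation at mul y x with F j0 y times the
    relation at x eliminates j0. *)
Lemma characters_indep (X : Type) (D : X -> Prop) (mul : X -> X -> X) (one : X)
    (F : J -> X -> K) :
    D one -> (forall x y, D x -> D y -> D (mul x y)) ->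
    (forall j, F j one = 1) ->
    (forall j x y, D x -> D y -> F j (mul x y) = F j x * F j y) ->
    (forall j j', (forall x, D x -> F j x = F j' x) -> j = j') ->
  lin_indep D F.
Proof.
move=> D1 DM F1 FM Finj; elim=> // j0 s IH c /= /andP[j0s su] h.
(* The tail of the relation, with coefficients multiplied by F j y - F j0 y. *)
have cs j : j \in s -> c j = 0.
  move=> js; apply: boolp.contrapT => cj; case/negP: j0s.
  suff -> : j0 = j by [].
  apply: Finj => y Dy; apply: boolp.contrapT => Fy; apply: cj.
  have := IH (fun j => c j * (F j y - F j0 y)) su.
  have hx x : D x -> \sum_(j1 <- s) c j1 * (F j1 y - F j0 y) * F j1 x = 0.
    move=> Dx; have := h _ (DM _ _ Dy Dx); have := h _ Dx.
    rewrite !big_cons => h1 h2.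
    transitivity (c j0 * F j0 (mul y x) + \sum_(j1 <- s) c j1 * F j1 (mul y x)
      - F j0 y * (c j0 * F j0 x + \sum_(j1 <- s) c j1 * F j1 x)); last first.
      by rewrite h1 h2 mulr0 subrr.
    rewrite mulrDr opprD addrACA FM //.
    rewrite [X in _ = X + _](_ : _ = 0) ?add0r; last by ring.
    by rewrite mulr_sumr -sumrB; apply: eq_bigr => j1 _; rewrite FM //; ring.
  move=> /(_ hx _ js) /eqP; rewrite mulf_eq0 subr_eq0 => /orP[/eqP //|/eqP h'].
  by case: Fy.
move=> j; rewrite in_cons => /orP[/eqP ->|]; last exact: cs.
have := h _ D1; rewrite big_cons F1 mulr1 big_seq big1 ?addr0 // => j1 j1s.
by rewrite cs ?mul0r.
Qed.

Lemma poly_vanish (p : {poly K}) : (forall x, p.[x] = 0) -> p = 0.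
Proof.
move=> h; apply/eqP; apply: contraT => p0.
(* The natural numbers below size p are too many roots. *)
have := max_poly_roots p0 (rs := [seq i%:R | i <- iota 0 (size p)]).
rewrite size_map size_iota ltnn; apply.
  by apply/allP => x _; rewrite rootE h.
by rewrite map_inj_uniq ?iota_uniq // => i k /eqP; rewrite eqr_nat => /eqP.
Qed.

(** The lowest term of p is v X^w, except that v may be 0. *)
Definition lead (w : nat) (v : K) (p : {poly K}) : Prop :=
  exists2 q : {poly K}, p = 'X^w * q & q.[0] = v.

Lemma leadC v : lead 0 v v%:P.
Proof. by exists v%:P; rewrite ?expr0 ?mul1r ?hornerC. Qed.

Lemma lead0 w : lead w 0 0.
Proof. by exists 0; rewrite ?mulr0 ?horner0. Qed.

Lemma leadD w v v' p p' : lead w v p -> lead w v' p' -> lead w (v + v') (p + p').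
Proof.
by move=> [q -> <-] [q' -> <-]; exists (q + q'); rewrite ?mulrDr ?hornerD.
Qed.

Lemma leadM w w' v v' p p' :
  lead w v p -> lead w' v' p' -> lead (w + w') (v * v') (p * p').
Proof.
move=> [q -> <-] [q' -> <-]; exists (q * q'); last by rewrite hornerM.
by rewrite exprD mulrACA.
Qed.

Lemma leadXn w : lead w 1 'X^w.
Proof. by exists 1; rewrite ?mulr1 ?hornerC. Qed.

Lemma lead_lt w w' v p : (w < w')%N -> lead w' v p -> lead w 0 p.
Proof.
move=> ww' [q -> _]; exists ('X^(w' - w) * q).
  by rewrite mulrA -exprD subnKC // ltnW.
by rewrite hornerM hornerXn expr0n subn_eq0 leqNgt ww' mul0r.
Qed.

Lemma lead_sum (I : Type) (r : seq I) (P : pred I) w v (p : I -> {poly K}) :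
    (forall i, P i -> lead w (v i) (p i)) ->
  lead w (\sum_(i <- r | P i) v i) (\sum_(i <- r | P i) p i).
Proof.
move=> h; elim/big_rec2: _ => [|i x y Pi xy]; first exact: lead0.
by apply: leadD => //; apply: h.
Qed.

Lemma lead_prod (I : Type) (r : seq I) (P : pred I) w v (p : I -> {poly K}) :
    (forall i, P i -> lead (w i) (v i) (p i)) ->
  lead (\sum_(i <- r | P i) w i) (\prod_(i <- r | P i) v i)
       (\prod_(i <- r | P i) p i).
Proof.
move=> h; elim/big_rec3: _ => [|i x y z Pi xyz]; first exact: leadC.
by apply: leadM => //; apply: h.
Qed.

Lemma lead_coef_lt w v p k : lead w v p -> (k < w)%N -> p`_k = 0.
Proof. by case=> q -> _ kw; rewrite coefXnM kw. Qed.

Lemma lead_coef_eq w v p : lead w v p -> p`_w = v.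
Proof. by case=> q -> <-; rewrite coefXnM ltnn subnn horner_coef0. Qed.

(** A relation between the F j is evaluated along polynomial curves, and the
    coefficients of lowest order give a relation between the L j.  The factor d
    discards the finitely many parameters where the curve may leave D'. *)
Lemma lin_indep_of_lead (X X' : Type) (D : X -> Prop) (D' : X' -> Prop)
    (F : J -> X' -> K) (L : J -> X -> K) (w : J -> nat) :
    lin_indep D L ->
    (forall x, D x -> exists d P, [/\ d != 0, (forall j, lead (w j) (L j x) (P j)) &
       forall t, d.[t] != 0 -> exists2 x', D' x' & forall j, F j x' = (P j).[t]]) ->
  lin_indep D' F.
Proof.
move=> indL hx s c su hF.
suff main k j : j \in s -> w j = k -> c j = 0 by move=> j js; apply: main js erefl.
have [b] := ubnP k; elim: b k j => // b IH k j0 kb j0s wj0.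
have c_small j : j \in s -> (w j < k)%N -> c j = 0.
  by move=> js wk; apply: (IH (w j)) => //; apply: leq_trans wk _.
suff h x : D x -> \sum_(j <- [seq j <- s | w j == k]) c j * L j x = 0.
  by apply: (indL _ c _ h); rewrite ?filter_uniq // mem_filter wj0 eqxx.
move=> Dx; have [d [P [d0 PL PF]]] := hx x Dx.
have P0 : \sum_(j <- s) c j *: P j = 0.
  apply: (mulfI d0); rewrite mulr0; apply: poly_vanish => t; rewrite hornerM.
  have [->|dt] := eqVneq d.[t] 0; first by rewrite mul0r.
  have [x' Dx' Fx'] := PF t dt.
  rewrite horner_sum -[X in _ * X](_ : \sum_(j <- s) c j * F j x' = _).
    by rewrite hF // mulr0.
  by apply: eq_bigr => j _; rewrite hornerZ Fx'.
have := congr1 (fun p : {poly K} => p`_k) P0; rewrite coef0 coef_sum => E.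
rewrite big_filter -[RHS]E big_mkcond big_seq [RHS]big_seq; apply: eq_bigr => j js.
rewrite coefZ; have [wk|wk|wk] := ltngtP (w j) k.
- by rewrite c_small ?mul0r.
- by rewrite (lead_coef_lt (PL j) wk) mulr0.
- by rewrite -wk (lead_coef_eq (PL j)).
Qed.

End Independence.

(** * A tableau is determined by its exponents *)

Section TableauExponents.
Variables (n N : nat) (e : 'I_n -> nat).
Hypothesis e_mono : forall i j : 'I_n, (i < j)%N -> (e i < e j)%N.
Local Notation col := (pbw_column N e).

(** The entry b stands in row a of c and exceeds the length: a factor x_ab of
    the initial monomial. *)
Definition large_pair (c : col) (a b : nat) : bool :=
  [exists s : 'I_(col_length c),
    [&& s == a :> nat, col_entry c s == b :> nat & (col_length c <= b)%N]].

Definition large_mult (T : seq col) (a b : nat) : nat :=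
  (\sum_(c <- T) large_pair c a b)%N.

Lemma pbw_next_trans : transitive (@pbw_next n N e).
Proof.
move=> y x z /andP[lxy /forallP hxy] /andP[lyz /forallP hyz].
apply/andP; split; first exact: leq_trans lyz lxy.
apply/forallP => i; have /existsP[j /andP[ij zy]] := hyz i.
have /existsP[k /andP[jk yx]] := hxy j.
by apply/existsP; exists k; rewrite (leq_trans ij jk) (leq_trans zy yx).
Qed.

(** Condition (3) and its transitivity: in a semi-standard tableau the large
    entries of all columns are dominated by those of the first one, provided
    that they exceed its length. *)
Lemma large_pair_dominated (T : seq col) c a b : pbw_column_ok c ->
    path (@pbw_next n N e) c T ->
    (0 < large_mult (c :: T) a b)%N -> (col_length c <= b)%N ->
  exists a' b', [/\ large_pair c a' b', (a <= a')%N & (b <= b')%N].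
Proof.
move=> ok /(order_path_min pbw_next_trans)/allP dom.
rewrite lt0n sum_nat_seq_neq0 => /hasP[d].
rewrite in_cons => /orP[/eqP ->|dT] /=; rewrite eqb0 negbK.
  by move=> h _; exists a, b.
case/existsP => s /and3P[/eqP sa /eqP sb _] cb.
have /andP[_ /forallP/(_ s)/existsP[t /andP[st ct]]] := dom d dT.
exists t, (col_entry c t); split; last by rewrite -sb.
  apply/existsP; exists t; rewrite !eqxx /=.
  by rewrite (leq_trans cb) // -sb.
by rewrite -sa.
Qed.

(** Large entries decrease down a column by condition (2). *)
Lemma large_pair_antichain c a b a' b' : pbw_column_ok c ->
    large_pair c a b -> large_pair c a' b' -> (a <= a')%N -> (b <= b')%N ->
  a = a' /\ b = b'.
Proof.
move=> ok /existsP[s /and3P[/eqP <- /eqP <- cb]] /existsP[s' /and3P[/eqP <- /eqP <- cb']].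
rewrite leq_eqVlt => /orP[/eqP/val_inj ->//|ss'].
by rewrite leqNgt (col_entry_decr ok cb cb' ss').
Qed.

(** A large pair of c occurs in T', so it is dominated by one of c', which in turn
    is dominated by one of c; since those of c form an antichain all three
    coincide. *)
Lemma large_pair_sub (T T' : seq col) c c' a b :
    pbw_column_ok c -> pbw_column_ok c' -> col_length c = col_length c' ->
    path (@pbw_next n N e) c T -> path (@pbw_next n N e) c' T' ->
    (forall a b, large_mult (c :: T) a b = large_mult (c' :: T') a b) ->
  large_pair c a b -> large_pair c' a b.
Proof.
move=> ok ok' lc cT cT' mE cab.
have lb : (col_length c <= b)%N by case/existsP: cab => s /and3P[].
have pos (d : col) S x y : large_pair d x y -> (0 < large_mult (d :: S) x y)%N.
  by rewrite /large_mult big_cons => ->.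
have [||a' [b' [c'ab aa' bb']]] := large_pair_dominated ok' cT' (a := a) (b := b).
- by rewrite -mE pos.
- by rewrite -lc.
have [||a'' [b'' [cab'' a'a'' b'b'']]] := large_pair_dominated ok cT (a := a') (b := b').
- by rewrite mE pos.
- by rewrite (leq_trans lb).
have [aE bE] := large_pair_antichain ok cab cab'' (leq_trans aa' a'a'') (leq_trans bb' b'b'').
have -> : a = a' by apply/eqP; rewrite eqn_leq aa' aE.
by have -> : b = b' by apply/eqP; rewrite eqn_leq bb' bE.
Qed.

Lemma column_from_large_pairs c c' : pbw_column_ok c -> pbw_column_ok c' ->
  tag c = tag c' -> (forall a b, large_pair c a b = large_pair c' a b) -> c = c'.
Proof.
case: c => i t; case: c' => i' t' /= ok ok' ii'; subst i' => h.
congr existT; apply: eq_from_tnth => s; apply: ord_inj.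
set c : col := existT _ i t in ok h *; set c' : col := existT _ i t' in ok' h *.
change (col_entry c s = col_entry c' s :> nat).
have lp (u : (e i).-tuple 'I_N) (s0 : 'I_(e i)) : (e i <= tnth u s0)%N ->
   large_pair (existT _ i u : col) s0 (tnth u s0).
  by move=> us; apply/existsP; exists s0; rewrite !eqxx.
have lpE (u : (e i).-tuple 'I_N) (s0 : 'I_(e i)) b :
   large_pair (existT _ i u : col) s0 b -> tnth u s0 = b :> nat.
  by case/existsP => s1 /and3P[/eqP/val_inj -> /eqP].
have [cs|cs] := leqP (e i) (tnth t s).
  by have := lp _ _ cs; rewrite -/c h => /lpE.
have [cs'|cs'] := leqP (e i) (tnth t' s).
  by have := lp _ _ cs'; rewrite -/c' -h => /lpE.
by rewrite (col_entry_own ok cs) (col_entry_own ok' cs').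
Qed.

Lemma tableau_from_exponents (T T' : seq col) :
    pbw_semistandard T -> pbw_semistandard T' ->
    (forall i, count (pred1 i) (map tag T) = count (pred1 i) (map tag T')) ->
    (forall a b, large_mult T a b = large_mult T' a b) ->
  T = T'.
Proof.
move=> sT sT' tE; have {tE} : map tag T = map tag T'.
  have srt (S : seq col) : pbw_semistandard S ->
      sorted (fun i j : 'I_n => (e j <= e i)%N) (map tag S).
    case/andP=> _; rewrite sorted_map; apply: sub_sorted => x y.
    by case/andP.
  apply: (sorted_eq _ _ (srt _ sT) (srt _ sT')).
  - by move=> j i k ij jk; apply: leq_trans jk ij.
  - by move=> i j /andP[ij ji]; apply: (dimension_inj e_mono); apply/eqP; rewrite eqn_leq ji ij.
  - by apply/allP => i _; rewrite /= tE eqxx.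
case/andP: sT => okT sT; case/andP: sT' => okT' sT'.
elim: T T' okT sT okT' sT' => [|c T IH] [|c' T'] //=
  /andP[okc okT] cT /andP[okc' okT'] cT' [tc tT] mE.
have lc : col_length c = col_length c' by rewrite /col_length tc.
have cE : c = c'.
  apply: column_from_large_pairs => // a b; apply/idP/idP.
    exact: large_pair_sub cT cT' mE.
  by apply: large_pair_sub cT' cT _ => // x y; rewrite mE.
subst c'; congr (_ :: _); apply: IH => //; try exact: path_sorted cT.
  exact: path_sorted cT'.
move=> a b; have := mE a b; rewrite /large_mult !big_cons => /eqP.
by rewrite eqn_add2l => /eqP.
Qed.

Section Characters.
Variable (K : numFieldType).

(** The initial monomial of a column, evaluated at x.1, times a scalar power that
    records the level of the column, and thereby the shape of a tableau. *)
Definition col_character (x : (nat -> nat -> K) * ('I_n -> K)) (c : col) : K :=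
  x.2 (tag c) ^+ col_length c *
  \prod_(s | (col_length c <= col_entry c s)%N) x.1 s (col_entry c s).

Lemma tableau_characters_indep :
    (forall i, (0 < e i)%N) ->
  lin_indep (fun x : (nat -> nat -> K) * ('I_n -> K) => forall i, x.2 i != 0)
    (fun (T : pbw_tableau N e) x => \prod_(c <- val T) col_character x c).
Proof.
move=> e0; apply: (@characters_indep K _ _ _
  (fun x y => (fun a b => x.1 a b * y.1 a b, fun i => x.2 i * y.2 i))
  (fun _ _ => 1, fun _ => 1)) => /=.
- by move=> i; apply: oner_neq0.
- by move=> x y hx hy i; rewrite mulf_neq0.
- by move=> T; rewrite big1 // => c _; rewrite /col_character expr1n big1 ?mulr1.
- move=> T x y _ _; rewrite -big_split; apply: eq_bigr => c _.
  by rewrite /col_character /= exprMn big_split /= mulrACA.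
move=> T T' h; apply: val_inj.
(* The evaluations at points with one coordinate 2 and all the others 1 read off
   the exponents. *)
have two : forall k k', (2 ^+ k == 2 ^+ k' :> K) = (k == k').
  by move=> k k'; rewrite -!natrX eqr_nat eqn_exp2l.
apply: tableau_from_exponents; try exact: valP.
  move=> i; pose x : (nat -> nat -> K) * ('I_n -> K) :=
    (fun _ _ => 1, fun j => if j == i then 2 else 1).
  have xE (S : seq col) : \prod_(c <- S) col_character x c =
      2 ^+ (e i * count (pred1 i) (map tag S)).
    elim: S => [|c S IH]; first by rewrite big_nil muln0 expr0.
    rewrite big_cons IH /= mulnDr exprD /col_character /= big1 // mulr1.
    by congr (_ * _); rewrite /col_length; case: eqP => [->|_]; rewrite ?muln1 ?muln0 ?expr1n.
  have := h x; rewrite !xE => hx.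
  have {hx} : 2 ^+ (e i * count (pred1 i) (map tag (val T))) ==
      2 ^+ (e i * count (pred1 i) (map tag (val T'))) :> K.
    by apply/eqP; apply: hx => j /=; case: ifP => _; rewrite ?oner_neq0 ?pnatr_eq0.
  by rewrite two eqn_pmul2l // => /eqP.
move=> a b; pose x : (nat -> nat -> K) * ('I_n -> K) :=
   (fun a' b' => if (a' == a) && (b' == b) then 2 else 1, fun _ => 1).
have xE (S : seq col) : \prod_(c <- S) col_character x c = 2 ^+ large_mult S a b.
  rewrite /large_mult; elim: S => [|c S IH]; first by rewrite !big_nil expr0.
  rewrite !big_cons IH exprD /col_character /= expr1n mul1r; congr (_ * _).
  have [/existsP[s /and3P[/eqP sa /eqP sb lb]]|/existsPn ns] := boolP (large_pair c a b).
    rewrite (bigD1 s) /= ?sb // sa !eqxx /= big1 ?mulr1 // => t /andP[_ ts].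
    by case: eqP => //= ta; case/eqP: ts; apply: ord_inj; rewrite ta sa.
  rewrite big1 ?expr0 // => s cs; case: eqP => //= sa; case: eqP => //= sb.
  by have := ns s; rewrite sa sb !eqxx -sb cs.
have := h x; rewrite !xE => hx; apply/eqP; rewrite -two; apply/eqP.
by apply: hx => i; apply: oner_neq0.
Qed.

End Characters.
End TableauExponents.

(** * The initial monomial of a minor *)

Section InitialTerm.
Variables (K : numFieldType) (n N : nat) (e : 'I_n -> nat).
Variables (c : pbw_column N e) (z : nat -> nat -> K).
Hypothesis ok : pbw_column_ok c.
Let p := col_length c.
Let T : 'I_p -> 'I_N := col_entry c.
Let wt (a : nat) (s : 'I_p) : nat := if (p <= T s)%N then (T s * N.+1 ^ a)%N else 0%N.

Let entry (a : nat) (s : 'I_p) : {poly K} := if (T s < p)%N then (a == T s :> nat)%:R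
  else (z a (T s))%:P * 'X^(T s * N.+1 ^ a).

(** At the last row where they differ, the filling a |-> T (s a) has a larger
    entry than T: all later rows agree, and T puts there the smallest of the
    remaining large entries, or an entry of weight 0.  The weights b (N + 1)^a
    turn this into a comparison of numbers in base N + 1. *)
Let wt_minimal (s : 'S_p) : s != 1%g ->
    (forall a : 'I_p, (T (s a) < p)%N -> T (s a) = a :> nat) ->
  (\sum_(a : 'I_p) wt a a < \sum_(a : 'I_p) wt a (s a))%N.
Proof.
move=> s1 sT.
have /existsP[a1 sa1] : [exists a, s a != a].
  apply: contraNT s1 => /existsPn h; apply/eqP/permP => a; rewrite perm1.
  by have := h a; rewrite negbK => /eqP.
have [a0 sa0 amax] := @arg_maxnP _ a1 (fun a => s a != a) (@nat_of_ord p) sa1.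
have fixed (a : 'I_p) : (a0 < a)%N -> s a = a.
  by move=> h; apply/eqP; apply: contraTT h => /amax; rewrite -leqNgt.
have Tbig : (p <= T (s a0))%N.
  rewrite leqNgt; apply: contra sa0 => h; apply/eqP; apply: ord_inj.
  by rewrite -(sT _ h) [RHS](col_entry_own ok h).
have sa0_lt : (s a0 < a0)%N.
  rewrite ltnNge leq_eqVlt negb_or; apply/andP; split.
    by apply: contra sa0 => /eqP h; apply/eqP; apply: ord_inj.
  by apply: contra sa0 => h; apply/eqP; have := fixed _ h; apply: perm_inj.
pose f k : nat := if (p <= T (insubd a0 k))%N then (T (insubd a0 k) : nat) else 0%N.
pose g k : nat := if (p <= T (s (insubd a0 k)))%N then (T (s (insubd a0 k)) : nat) else 0%N.
have -> : (\sum_(a : 'I_p) wt a a = \sum_(k < p) f k * N.+1 ^ k)%N.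
  by apply: eq_bigr => a _; rewrite /wt /f valKd; case: ifP.
have -> : (\sum_(a : 'I_p) wt a (s a) = \sum_(k < p) g k * N.+1 ^ k)%N.
  by apply: eq_bigr => a _; rewrite /wt /g valKd; case: ifP.
apply: (@digits_lt N.+1 p f g a0) => //.
- by move=> k _; rewrite /f; case: ifP => // _; rewrite ltnS ltnW.
- rewrite /f /g valKd Tbig; have [h|h] := leqP p (T a0).
    exact: (col_entry_decr ok Tbig h sa0_lt).
  by rewrite (leq_trans _ Tbig) // (leq_ltn_trans _ (ltn_ord a0)).
- move=> k /andP[ak kp]; have kE : insubd a0 k = k :> nat by rewrite val_insubd kp.
  by rewrite /f /g fixed // kE.
Qed.

Lemma minor_initial :
  lead (\sum_(s | (p <= T s)%N) T s * N.+1 ^ s)%N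
    (\prod_(s | (p <= T s)%N) z s (T s))
    (\det (\matrix_(a < p, s < p) entry a s)).
Proof.
rewrite big_mkcond [X in lead _ X _]big_mkcond /=.
set w := (\sum_s _)%N; set v := \prod_s _.
have wE : w = (\sum_(a : 'I_p) wt a a)%N by [].
have entry_lead (a : nat) s : (T s < p)%N && (T s != a :> nat) = false ->
    lead (wt a s) (if (p <= T s)%N then z a (T s) else 1) (entry a s).
  rewrite /wt /entry; have [Tp|Tp] := ltnP (T s) p => /=.
    by move=> /negbFE /eqP ->; rewrite eqxx; apply: leadC.
  move=> _; have := leadM (leadC (z a (T s))) (leadXn K (T s * N.+1 ^ a)).
  by rewrite add0n mulr1.
have -> : v = \sum_(s : 'S_p) (if s == 1%g then v else 0).
  by rewrite -big_mkcond big_pred1_eq.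
apply: lead_sum => s _.
have -> : (-1) ^+ s = ((-1) ^+ s)%:P :> {poly K} by rewrite rmorph_sign.
have [->|s1] := eqVneq s 1%g.
  rewrite odd_perm1 expr0 polyC1 mul1r wE.
  apply: lead_prod => a _; rewrite mxE perm1; apply: entry_lead.
  by case: ltnP => //= h; rewrite (col_entry_own ok h) eqxx.
have [/existsP[a sa]|/existsPn nsa] :=
    boolP [exists a : 'I_p, (T (s a) < p)%N && (T (s a) != a :> nat)].
  rewrite (bigD1 a) //= mxE /entry; case/andP: sa => -> /negPf sa.
  by rewrite eq_sym sa mul0r mulr0; apply: lead0.
have sw : (w < 0 + \sum_(a : 'I_p) wt a (s a))%N.
  rewrite add0n wE; apply: wt_minimal => // a h.
  by have := nsa a; rewrite h /= negbK => /eqP.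
apply: (lead_lt sw); apply: leadM; first exact: leadC.
apply: lead_prod => a _; rewrite mxE; apply: entry_lead.
by apply: negbTE.
Qed.

End InitialTerm.

(** * A chart of the quiver Grassmannian *)

Section ChartDef.
Variables (R : comNzRingType) (N : nat) (E : nat -> nat).

(** The row a of the matrix (1 | x) with E k unit columns. *)
Definition chart_row (x : nat -> nat -> R) (k a : nat) : 'rV[R]_N :=
  \row_b (if (b < E k)%N then (a == b :> nat)%:R else x a b).

(** A basis of U_k: the images under the arrow of the basis of U_(k-1), followed
    by new vectors.  Not normalizing it keeps all entries polynomial in x. *)
Fixpoint chart (f : nat -> 'M[R]_N) (x : nat -> nat -> R) (k a : nat) : 'rV[R]_N :=
  if k is k'.+1 then
    if (a < E k')%N then chart f x k' a *m f k' else chart_row x k a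
  else chart_row x 0 a.

End ChartDef.

Section Chart.
Variables (K : numFieldType) (N : nat) (E : nat -> nat).
Hypothesis Ei : forall k, (E k <= E k.+1)%N.
Variable F : nat -> 'M[K]_N.
Hypothesis nF : forall k, normal_arrow (E k) (E k.+1) (F k).
Variable x : nat -> nat -> K.

(** The chart of M at the point X x, where X is the variable. *)
Definition poly_chart : nat -> nat -> 'rV[{poly K}]_N :=
  chart E (fun k => map_mx polyC (F k)) (fun a b => 'X * (x a b)%:P).

(** The contraction of F by the one-parameter group: at X = 0 the free block
    disappears. *)
Let ft (k : nat) : 'M[{poly K}]_N :=
  \matrix_(a, b) if (E k <= a)%N && (b < E k.+1)%N then 'X * (F k a b)%:P
                 else (F k a b)%:P.
Let Q : nat -> nat -> 'rV[{poly K}]_N := chart E ft (fun a b => (x a b)%:P).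
(** The one-parameter group, which conjugates F to ft. *)
Let D (k b : nat) : {poly K} := if (b < E k)%N then 1 else 'X.

Let poly_chart_factor k a b : poly_chart k a 0 b = Q k a 0 b * D k b.
Proof.
have base l : chart_row N E (fun a b => 'X * (x a b)%:P) l a 0 b =
   chart_row N E (fun a b => (x a b)%:P) l a 0 b * D l b.
  by rewrite !mxE /D; case: ifP => _; rewrite ?mulr1 // mulrC.
elim: k b base => [|k IH] b base; first exact: base.
rewrite /poly_chart /Q /=; case: ifP => [ak|_]; last exact: base.
rewrite !mxE mulr_suml; apply: eq_bigr => c _.
rewrite -/(poly_chart k a) IH; last first.
  by move=> l; rewrite !mxE /D; case: ifP => _; rewrite ?mulr1 // mulrC.
rewrite -/Q -!mulrA; congr (_ * _); rewrite !mxE.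
have := @nF k c b; rewrite /D [(E k <= c)%N]leqNgt [(E k.+1 <= b)%N]leqNgt.
have [cE|cE] := ltnP c (E k); have [bE|bE] := ltnP b (E k.+1) => /=.
- by move=> _; rewrite mul1r mulr1.
- move=> ->//; have [cb|_] := eqVneq c b; last by rewrite mul0r mulr0.
  by move: cE; rewrite cb ltnNge (leq_trans (Ei k) bE).
- by move=> _; rewrite mulr1.
- by move=> _; rewrite mulrC.
Qed.

Let Q0 k a b : (a < E k)%N -> (Q k a 0 b).[0] = chart_row N E x k a 0 b.
Proof.
have base l c : (chart_row N E (fun a b => (x a b)%:P) l a 0 c).[0] =
    chart_row N E x l a 0 c.
  by rewrite !mxE; case: ifP => _; rewrite ?hornerC // -polyC_natr hornerC.
elim: k b => [|k IH] b ak; first exact: base.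
rewrite /Q /=; case: ifP => [ak'|_]; last exact: base.
rewrite mxE horner_sum (bigD1 b) //= big1 ?addr0 => [|c cb]; last first.
  rewrite hornerM mxE; case: ifP => h.
    by rewrite hornerM hornerX mul0r mulr0.
  rewrite nF ?(negPf cb) ?hornerC ?mulr0 //.
  by rewrite ltnNge [(E k.+1 <= b)%N]leqNgt -negb_and h.
rewrite hornerM -/Q IH // !mxE.
have [bE|bE] := leqP (E k) b; last first.
  rewrite /= (leq_trans bE (Ei k)) nF ?bE // eqxx hornerC mulr1.
  by [].
have [bE'|bE'] := ltnP b (E k.+1) => /=.
  by rewrite hornerM hornerX mul0r mulr0 ltn_eqF // (leq_trans ak').
by rewrite nF ?bE' ?orbT // eqxx hornerC mulr1.
Qed.

(** The one-parameter group contributes a factor X for each column outside the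
    first E k ones; what remains specializes at X = 0 to the matrix (1 | x). *)
Lemma minor_chart_lead k p (l : 'I_p -> 'I_N) : (p <= E k)%N ->
  lead (\sum_s (E k <= l s)) (\det (\matrix_(a < p, s < p) chart_row N E x k a 0 (l s)))
    (\det (\matrix_(a < p, s < p) poly_chart k a 0 (l s))).
Proof.
move=> pE.
have -> : \matrix_(a < p, s < p) poly_chart k a 0 (l s) =
  (\matrix_(a < p, s < p) Q k a 0 (l s)) *m diag_mx (\row_s D k (l s)).
  by rewrite mul_mx_diag; apply/matrixP => a s; rewrite !mxE poly_chart_factor.
rewrite det_mulmx det_diag -[w in lead w]add0n -[v in lead _ v]mulr1.
apply: leadM.
  exists (\det (\matrix_(a < p, s < p) Q k a 0 (l s))); first by rewrite expr0 mul1r.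
  rewrite -horner_evalE -det_map_mx; congr (\det _); apply/matrixP => a s.
  rewrite [RHS]mxE -Q0 ?(leq_trans (ltn_ord a)) // -horner_evalE.
  by rewrite [LHS]mxE mxE.
have -> : 1 = \prod_(s < p) (1 : K) by rewrite big1.
apply: lead_prod => s _; rewrite mxE /D leqNgt.
by case: ifP => _ /=; [exact: leadC|rewrite -['X]expr1; exact: leadXn].
Qed.

End Chart.

(** * Semi-standard monomials are independent *)

Section Assembly.
Variables (K : numFieldType) (m N : nat) (e : 'I_m.+1 -> nat).
Hypotheses (e_gt0 : forall i, (0 < e i)%N) (e_le : forall i, (e i <= N)%N).
Hypothesis e_mono : forall i j : 'I_m.+1, (i < j)%N -> (e i < e j)%N.
Local Notation col := (pbw_column N e).
Local Notation E := (dimn e).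

Lemma tableau_ok (T : pbw_tableau N e) : all (@pbw_column_ok _ N e) (val T).
Proof. by case/andP: (valP T). Qed.

(** The Plücker coordinate of a column at the row spaces of (1 | x), that is on
    the quiver Grassmannian of the most degenerate representation, with bases
    rescaled at each vertex. *)
Definition flat_minor (x : (nat -> nat -> K) * ('I_m.+1 -> K)) (c : col) : K :=
  x.2 (tag c) ^+ col_length c *
  \det (\matrix_(a < col_length c, s < col_length c)
          chart_row N E x.1 (tag c) a 0 (col_entry c s)).

Definition nonzero_scales (x : (nat -> nat -> K) * ('I_m.+1 -> K)) : Prop :=
  forall i, x.2 i != 0.

Lemma flat_minors_indep : lin_indep nonzero_scales
  (fun (T : pbw_tableau N e) x => \prod_(c <- val T) flat_minor x c).
Proof.
pose w (c : col) := (\sum_(s | (col_length c <= col_entry c s)%N)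
                      col_entry c s * N.+1 ^ s)%N.
apply: (@lin_indep_of_lead K _ _ _ _ _ _ _ (fun T => \sum_(c <- val T) w c)%N
  (tableau_characters_indep (K := K) e_mono e_gt0)) => -[z y] /= yz.
pose P (c : col) : {poly K} := (y (tag c) ^+ col_length c)%:P *
  \det (\matrix_(a < col_length c, s < col_length c)
     (if (col_entry c s < col_length c)%N then (a == col_entry c s :> nat)%:R
      else (z a (col_entry c s))%:P * 'X^(col_entry c s * N.+1 ^ a))).
exists 1, (fun T => \prod_(c <- val T) P c); split=> [|T|t _].
- exact: oner_neq0.
- have /allP ok := tableau_ok T.
  rewrite !big_seq; apply: lead_prod => c /ok okc.
  rewrite -[w c]add0n; apply: leadM; first exact: leadC.
  exact: minor_initial.
exists (fun a b => z a b * t ^+ (b * N.+1 ^ a), y) => // T.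
rewrite horner_prod; apply: eq_bigr => c _; rewrite hornerM hornerC.
congr (_ * _); rewrite -horner_evalE -det_map_mx; congr (\det _).
apply/matrixP => a s; rewrite !mxE dimnE -/(col_length c).
case: ifP => _; first by rewrite rmorph_nat.
by rewrite rmorphM /= horner_evalE hornerC horner_evalE hornerXn.
Qed.

Variable M : quiver_rep K m.+1 N.
Hypothesis nM : forall k,
  normal_arrow (e (arrow_src k)) (e (arrow_tgt k)) (M k).
Local Notation bases := (forall i, (e i).-tuple 'rV[K]_N).

Definition is_point (b : bases) : Prop :=
  exists2 U, quiver_grassmannian e M U & forall i, basis_of (U i) (b i).

Let F := arrown M.

Lemma arrown_normal k : normal_arrow (E k) (E k.+1) (F k).
Proof.
have [km|mk] := ltnP k m.
  have := @nM (Ordinal km); rewrite -(dimn_src e (Ordinal km)) -(dimn_tgt e (Ordinal km)).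
  by rewrite -(arrownE M (Ordinal km)).
have -> : E k.+1 = E k.
  by rewrite /dimn (minn_idPr _) ?(minn_idPr _) // ltnW.
by rewrite /F arrown_id //; apply: normal_arrow1.
Qed.

Lemma dimn_leS k : (E k <= E k.+1)%N.
Proof. exact: (dimn_mono (dimension_mono e_mono)). Qed.

Definition chart_basis (x : nat -> nat -> K) (y : 'I_m.+1 -> K) (t : K) : bases :=
  fun i => [tuple y i *: map_mx (horner_eval t) (poly_chart E F x i a) | a < e i].

Lemma chart_basisE x y t i (a : 'I_(e i)) :
  (chart_basis x y t i)`_a = y i *: map_mx (horner_eval t) (poly_chart E F x i a).
Proof. by rewrite -tnth_nth tnth_mktuple. Qed.

Lemma minor_chart_basis x y t i (l : 'I_(e i) -> 'I_N) :
  minor (chart_basis x y t i) l = y i ^+ e i *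
    (\det (\matrix_(a < e i, s < e i) poly_chart E F x i a 0 (l s))).[t].
Proof.
rewrite -horner_evalE -det_map_mx -detZ; congr (\det _); apply/matrixP => a s.
by rewrite !mxE chart_basisE !mxE.
Qed.

(** Where this polynomial does not vanish the vectors of the chart are free. *)
Definition chart_det (x : nat -> nat -> K) : {poly K} :=
  \prod_i \det (\matrix_(a < e i, s < e i)
     poly_chart E F x i a 0 (widen_ord (e_le i) s)).

Lemma chart_det_neq0 x : chart_det x != 0.
Proof.
suff h i : (\det (\matrix_(a < e i, s < e i)
     poly_chart E F x i a 0 (widen_ord (e_le i) s))).[0] = 1.
  apply/eqP => /(congr1 (horner^~ 0)); rewrite horner0 horner_prod => /eqP.
  by rewrite big1 ?oner_eq0 // => i _; rewrite h.
have := @minor_chart_lead K N E dimn_leS F arrown_normal x i (e i)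
  (widen_ord (e_le i)); rewrite dimnE => /(_ (leqnn _)).
rewrite (_ : \det _ = 1); last first.
  rewrite -[RHS](det1 _ (e i)); congr (\det _); apply/matrixP => a s.
  by rewrite !mxE dimnE /= ltn_ord.
rewrite big1 => [|s _]; last by rewrite /= leqNgt ltn_ord.
by move/lead_coef_eq; rewrite horner_coef0.
Qed.

Lemma chart_basis_point x y t : (forall i, y i != 0) ->
  (chart_det x).[t] != 0 -> is_point (chart_basis x y t).
Proof.
move=> y0 dt; pose b := chart_basis x y t.
have bfree i : free (b i).
  apply/freeP => k k0.
  pose A : 'M[K]_(e i) := \matrix_(a, s) (b i)`_a 0 (widen_ord (e_le i) s).
  have Au : A \in unitmx.
    rewrite unitmxE unitfE -[\det A]/(minor (b i) (widen_ord (e_le i))).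
    rewrite minor_chart_basis mulf_neq0 ?expf_neq0 //.
    by apply: contraNneq dt => h; rewrite /chart_det horner_prod (bigD1 i) //= h mul0r.
  have : \row_a k a *m A = 0.
    apply/rowP => s; rewrite mxE [RHS]mxE.
    have := congr1 (fun v : 'rV[K]_N => v 0 (widen_ord (e_le i) s)) k0.
    rewrite summxE [RHS]mxE => h; rewrite -[RHS]h.
    by apply: eq_bigr => a _; rewrite [RHS]mxE [in LHS]mxE [X in _ * X]mxE.
  move/(congr1 (mulmx^~ (invmx A))); rewrite mulmxK // mul0mx => /rowP h a.
  by have := h a; rewrite !mxE.
exists (fun i => <<b i>>%VS); last by move=> i; rewrite /basis_of eqxx bfree.
split=> [i|k u]; first by rewrite (eqP (bfree i)) size_tuple.
move=> /coord_span ->; rewrite mulmx_suml; apply: memv_suml => a _.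
rewrite -scalemxAl; apply: memvZ.
have ka := ltn_ord a; have aT : (a < e (arrow_tgt k))%N.
  by rewrite (leq_trans ka) // (dimension_mono e_mono) //= leqnSn.
have -> : (b (arrow_src k))`_a *m M k =
    (y (arrow_src k) / y (arrow_tgt k)) *: (b (arrow_tgt k))`_(Ordinal aT).
  rewrite !chart_basisE scalerA divfK // -scalemxAl; congr (_ *: _).
  have -> : poly_chart E F x (arrow_tgt k) (Ordinal aT) =
            poly_chart E F x (arrow_src k) a *m map_mx polyC (M k).
    rewrite /poly_chart /= -[X in (_ < X)%N](dimnE e (arrow_src k)) in ka *.
    by rewrite ka /F arrownE.
  rewrite map_mxM -map_mx_comp; congr (_ *m _).
  by apply/matrixP => i j; rewrite !mxE /= horner_evalE hornerC.
by apply: memvZ; apply: memv_span; rewrite mem_nth // size_tuple.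
Qed.

Lemma tableau_minors_indep : lin_indep is_point
  (fun (T : pbw_tableau N e) b => \prod_(c <- val T) minor (b (tag c)) (col_entry c)).
Proof.
refine (@lin_indep_of_lead K _ _ _ _ is_point _ _
  (fun T : pbw_tableau N e =>
     \sum_(c <- val T) \sum_s (E (tag c) <= col_entry c s))%N
  flat_minors_indep _) => -[x y] /= y0.
exists (chart_det x), (fun T => \prod_(c <- val T) ((y (tag c) ^+ col_length c)%:P *
  \det (\matrix_(a < col_length c, s < col_length c)
     poly_chart E F x (tag c) a 0 (col_entry c s)))); split.
- exact: chart_det_neq0.
- move=> T; apply: lead_prod => c _; rewrite -[w in lead w]add0n.
  apply: leadM; first exact: leadC.
  apply: (minor_chart_lead dimn_leS arrown_normal).
  by rewrite dimnE.
move=> t dt; exists (chart_basis x y t); first exact: chart_basis_point.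
move=> T; rewrite horner_prod; apply: eq_bigr => c _.
by rewrite hornerM hornerC -minor_chart_basis.
Qed.

Lemma pbw_monomials_free (s : seq (pbw_tableau N e)) (c : pbw_tableau N e -> K) :
    uniq s -> \sum_(T <- s) c T *: coord_pi M (pbw_monomial K T) = 0 ->
  forall T, T \in s -> c T = 0.
Proof.
move=> su s0.
have e_inj := dimension_inj e_mono.
have eps0 (d : col) : exists eps : bool, pbw_column_ok d ->
    forall b : bases, (column_var K d).@[plucker_point b]
     = (-1) ^+ eps * minor (b (tag d)) (col_entry d).
  have [/(column_minor K e_inj)[eps h]|nok] := boolP (pbw_column_ok d).
    by exists eps.
  by exists false.
have [eps epsP] := boolp.choice eps0.
pose sg (T : pbw_tableau N e) : K := \prod_(d <- val T) (-1) ^+ eps d.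
have sg0 T : sg T != 0.
  by rewrite /sg prodf_seq_neq0; apply/allP => d _; rewrite /= signr_eq0.
have monE T b : (pbw_monomial K T).@[plucker_point b] =
    sg T * \prod_(d <- val T) minor (b (tag d)) (col_entry d).
  have /allP ok := tableau_ok T.
  rewrite /pbw_monomial rmorph_prod /sg -big_split big_seq [RHS]big_seq.
  by apply: eq_bigr => d dT; rewrite /= epsP ?ok.
have sI : \sum_(T <- s) c T *: pbw_monomial K T \in @vanishing_ideal K _ N e M.
  rewrite -[X in X \in _]subr0 -coord_piP coord_pi_sum coord_pi0; apply/eqP.
  by rewrite -[RHS]s0; apply: eq_bigr => T _; apply: coord_piZ.
suff van b : is_point b ->
    \sum_(T <- s) c T * sg T * \prod_(d <- val T) minor (b (tag d)) (col_entry d) = 0.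
  move=> T Ts; have := tableau_minors_indep su van Ts.
  by move/eqP; rewrite mulf_eq0 (negPf (sg0 T)) orbF => /eqP.
move=> [U UM bU].
have [l lG lE] : ideal_generated (fun g => multihomogeneous g /\
    vanishes_on_grassmannian M g) (\sum_(T <- s) c T *: pbw_monomial K T).
  exact/boolp.asboolP.
transitivity ((\sum_(T <- s) c T *: pbw_monomial K T).@[plucker_point b]).
  rewrite raddf_sum; apply: eq_bigr => T' _.
  by rewrite /= mevalZ monE mulrA.
rewrite lE raddf_sum big_seq big1 // => x xl; rewrite /= mevalM.
have [_ van] := lG _ xl.
by rewrite (van U UM b bU) mulr0.
Qed.

End Assembly.

Theorem theoremC (R : realType) (n N : nat) (e : 'I_n -> nat)
  (n_ge1 : (1 <= n)%N) (N_geSn : (n.+1 <= N)%N)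
  (e_ge1 : forall i, (1 <= e i)%N) (e_ltN : forall i, (e i < N)%N)
  (e_incr : forall i j : 'I_n, (i < j)%N -> (e i < e j)%N)
  (O : quiver_rep R[i] n N -> Prop) :
  is_orbit O ->
  degenerates_to O (rank_orbit (fun i j : 'I_n => (N - e j + e i)%N)) ->
  exists2 M : quiver_rep R[i] n N, O M &
    is_basis (fun T : pbw_tableau N e => coord_pi M (pbw_monomial R[i] T)).
Proof.
move=> [f0 Of] deg; case: n => [|m] in e n_ge1 N_geSn e_ge1 e_ltN e_incr O f0 Of deg *.
  by [].
have e_le i : (e i <= N)%N by rewrite ltnW.
have [M fM nM] := normal_rep_exists e_le (dimension_mono e_incr)
  (degeneration_corank e_le (dimension_mono e_incr) Of deg).
exists M; first by apply/Of.
split; first exact: pbw_monomials_free.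
by move=> v; apply: pbw_monomials_span.
Qed.
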